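(* Let $\mathbb{F}$ be a field of characteristic not two, $\eta\in\mathbb{F}\setminus\{1,\frac12\}$, and let $A$ be a $\mathcal{PC}(\eta)$-axial algebra over $\mathbb{F}$ generated by primitive axes $a,b,c$. Let $(\cdot,\cdot)$ be the Frobenius form on $A$ with $(x,x)=1$ for all primitive axes $x$, and put $\alpha=(a,b)$, $\beta=(b,c)$, $\gamma=(a,c)$, $\psi=(a,bc)=(b,ac)=(c,ab)$. Write $p=ab$, $q=bc$, $r=ac$, $s=a(bc)$, $t=b(ac)$. (1) $A$ is the linear span of $\mathcal{B}=\{a,b,c,p,q,r,s,t\}$. (2) If $\eta=-1$, the pairwise products of elements of $\mathcal{B}$ are given by the list $L(-1)$ in the context; if $\eta\ne-1$, they are given by the list $L(\eta)$ in the context. (3) If $\eta=-1$, then the values of the form on $\mathcal{B}$ are: $(a,a)=(b,b)=(c,c)=1$, $(a,b)=\alpha$, $(a,c)=\gamma$, $(b,c)=\beta$; $(a,p)=\alpha$, $(a,q)=\psi$, $(a,r)=\gamma$, $(a,s)=\psi$, $(a,t)=\alpha\gamma+\frac{\beta-\psi}{2}$; $(b,p)=\alpha$, $(b,q)=\beta$, $(b,r)=\psi$, $(b,s)=\alpha\beta+\frac{\gamma-\psi}{2}$, $(b,t)=\psi$; $(c,p)=\psi$, $(c,q)=\beta$, $(c,r)=\gamma$, $(c,s)=(c,t)=\beta\gamma+\frac{\alpha-\psi}{2}$; $(p,p)=\frac{2\alpha^2-\alpha+1}{2}$, $(p,q)=\frac{2\alpha\beta+\gamma-\psi}{2}$,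 $(p,r)=\frac{2\alpha\gamma+\beta-\psi}{2}$, $(p,s)=\frac{4\alpha\psi+2\beta+\psi-2\alpha\beta-\gamma}{4}$, $(p,t)=\frac{4\alpha\psi+2\gamma+\psi-2\alpha\gamma-\beta}{4}$; $(q,q)=\frac{2\beta^2-\beta+1}{2}$, $(q,r)=\frac{2\beta\gamma+\alpha-\psi}{2}$, $(q,s)=\frac{(6\beta-1)(\alpha+\gamma)-(4\beta+2)\psi}{4}$, $(q,t)=\frac{4\beta\psi+2\gamma+\psi-2\beta\gamma-\alpha}{4}$; $(r,r)=\frac{2\gamma^2-\gamma+1}{2}$, $(r,s)=\frac{4\gamma\psi+2\beta+\psi-2\beta\gamma-\alpha}{4}$, $(r,t)=\frac{(6\gamma-1)(\alpha+\beta)-(4\gamma+2)\psi}{4}$; $(s,s)=\frac18(4\beta^2-6\beta\gamma-6\alpha\beta+4\beta\psi+8\psi^2+\alpha-2\beta+\gamma+2\psi+2)$; $(s,t)=\frac18(8\alpha\beta\gamma+6\alpha^2-6\alpha\psi-2\beta^2+6\beta\gamma+2\beta\psi-2\gamma^2+2\gamma\psi-4\psi^2-2\alpha+\beta+\gamma-\psi-1)$; $(t,t)=\frac18(4\gamma^2-6\alpha\gamma-6\beta\gamma+4\gamma\psi+8\psi^2+\alpha+\beta-2\gamma+2\psi+2)$; and the determinant of the resulting $8\times8$ Gram matrix of $(a,b,c,p,q,r,s,t)$ equals $$\frac{3}{2^9}(\alpha+\beta+\gamma-2\psi-1)^4\bigl(12\alpha\beta\gamma-2\alpha^2-2\bet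a^2-2\gamma^2-2\psi^2+2\alpha\beta+2\beta\gamma+2\alpha\gamma-4\alpha\psi-4\beta\psi-4\gamma\psi+\alpha+\beta+\gamma-2\psi+1\bigr)^3.$$
   Context: Algebras are not assumed associative or unital. For a commutative $\mathbb{F}$-algebra $A$, $a\in A$ and $\lambda\in\mathbb{F}$, put $A_\lambda(a)=\{u\in A\mid au=\lambda u\}$. A ($\mathcal{PC}(\eta)$-)axis in $A$ is an idempotent $a\in A$ such that $A=A_1(a)\oplus A_\eta(a)\oplus A_{1/2}(a)$ and the fusion law $\mathcal{PC}(\eta)$ holds: $A_1(a)A_1(a)\subseteq A_1(a)$, $A_1(a)A_\eta(a)\subseteq A_\eta(a)$, $A_1(a)A_{1/2}(a)\subseteq A_{1/2}(a)$, $A_\eta(a)A_\eta(a)\subseteq A_1(a)$, $A_\eta(a)A_{1/2}(a)\subseteq A_{1/2}(a)$, $A_{1/2}(a)A_{1/2}(a)\subseteq A_1(a)\oplus A_\eta(a)$. An axis $a$ is primitive if $A_1(a)=\langle a\rangle$ is $1$-dimensional. A $\mathcal{PC}(\eta)$-axial algebra is a commutative $\mathbb{F}$-algebra generated by a set of axes. A Frobenius form is a non-zero symmetric bilinear form with $(xy,z)=(x,yz)$ for all $x,y,z$; an algebra generated by primitive $\mathcal{PC}(\eta)$-axes has exactly one Frobenius form with $(x,x)=1$ for all primitive axes $x$. **List $L(-1)$** (depending on $\alpha,\beta,\gamma,\psi$; products are commutative): $a^2=a$, $b^2=b$, $c^2=c$, $ab=p$, $ac=r$, $bc=q$, $aq=s$,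 $br=t$, $cp=\beta a+\gamma b+\alpha c-s-t$; $ap=\alpha a+\frac12b-\frac12p$, $ar=\gamma a+\frac12c-\frac12r$, $bp=\alpha b+\frac12a-\frac12p$, $bq=\beta b+\frac12c-\frac12q$, $cr=\gamma c+\frac12a-\frac12r$, $cq=\beta c+\frac12b-\frac12q$; $as=\psi a+\frac12q-\frac12s$, $bt=\psi b+\frac12r-\frac12t$; $bs=\frac14(\beta a+(\gamma-2\psi)b-3\alpha c-2\beta p+6\alpha q-r+2s+2t)$; $cs=\frac14(3\beta a-\gamma b+(3\alpha-2\psi)c-p+6\gamma q-2\beta r-2t)$; $at=\frac14((\beta-2\psi)a+\gamma b-3\alpha c-2\gamma p-q+6\alpha r+2s+2t)$; $ct=\frac14(-\beta a+3\gamma b+(3\alpha-2\psi)c-p-2\gamma q+6\beta r-2s)$; $p^2=\frac14((6\alpha-1)(a+b)-(4\alpha+2)p)$, $q^2=\frac14((6\beta-1)(b+c)-(4\beta+2)q)$, $r^2=\frac14((6\gamma-1)(a+c)-(4\gamma+2)r)$; $pq=\frac14(3\beta a+(6\psi-\gamma)b+3\alpha c-2\beta p-2\alpha q-r-2t)$; $qr=\frac14(\beta a+\gamma b+(6\psi-3\alpha)c-p-2\gamma q-2\beta r+2s+2t)$; $pr=\frac14((6\psi-\beta)a+3\gamma b+3\alpha c-2\gamma p-q-2\alpha r-2s)$; $ps=\frac18((12\alpha\beta-2\beta+6\gamma-6\psi)a+(6\psi-2\beta)b-c-4(\beta+\psi)p+(6\alpha+1)q-2r+(2-4\alpha)s)$;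 $pt=\frac18((6\psi-2\gamma)a+(12\alpha\gamma+6\beta-2\gamma-6\psi)b-c-4(\gamma+\psi)p-2q+(6\alpha+1)r+(2-4\alpha)t)$; $qs=\frac18((4\beta^2-2\beta+2)a+(1-6\beta)p+8\psi q+(1-6\beta)r+(4\beta+2)s)$; $qt=\frac18(-a+(12\beta\gamma+6\alpha-2\gamma-6\psi)b+(6\psi-2\gamma)c-2p-4(\gamma+\psi)q+(6\beta+1)r+(2-4\beta)t)$; $rs=\frac18((12\beta\gamma+6\alpha-2\beta-6\psi)a-b+(6\psi-2\beta)c-2p+(6\gamma+1)q-4(\beta+\psi)r+(2-4\gamma)s)$; $rt=\frac18((4\gamma^2-2\gamma+2)b+(1-6\gamma)p+(1-6\gamma)q+8\psi r+(4\gamma+2)t)$; $s^2=\frac1{16}((36\alpha\beta-4\beta^2+36\beta\gamma-24\beta\psi-6\alpha+2\beta-6\gamma-12\psi-2)a+(1-6\beta)(b+c)+2(1-6\beta)(p+r)+(4\beta+24\psi+2)q+(8\beta-16\psi+4)s)$; $t^2=\frac1{16}((1-6\gamma)(a+c)+(36\alpha\gamma+36\beta\gamma-4\gamma^2-24\gamma\psi-6\alpha-6\beta+2\gamma-12\psi-2)b+(2-12\gamma)(p+q)+(4\gamma+24\psi+2)r+(8\gamma-16\psi+4)t)$; $st=\frac1{16}((12\beta\psi-6\alpha\beta-2\beta^2-14\beta\gamma+\beta+6\gamma+6\psi+1)a+(12\gamma\psi-6\alpha\gamma-14\beta\gamma-2\gamma^2+6\beta+\gamma+6\psi+1)b+(18\alpha^2+6\alpha\beta+6\alpha\gamma-36\alpha\psi+3\alpha-6\psi-2)c+(6\gamma-6\alpha+6\beta-32\beta\gamma+12\psi-1)p+(24\alpha\gamma-6\alpha+2\beta+6\gamma-12\psi-1)q+(24\alpha\beta-6\alpha+6\beta+2\gamma-12\psi-1)r+(8\gamma-12\alpha-4\beta+16\psi-4)s+(8\beta-12\alpha-4\gamma+16\psi-4)t)$.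 **List $L(\eta)$, $\eta\neq-1$** (products are commutative): $a^2=a$, $b^2=b$, $c^2=c$, $ab=p$, $ac=r$, $bc=q$, $aq=s$, $br=t$, $cp=(\eta+1)(p+q+r)-\eta(a+b+c)-s-t$; $ap=\frac12((1-\eta)a-\eta b+(1+2\eta)p)$, $ar=\frac12((1-\eta)a-\eta c+(1+2\eta)r)$, $bp=\frac12((1-\eta)b-\eta a+(1+2\eta)p)$, $bq=\frac12((1-\eta)b-\eta c+(1+2\eta)q)$, $cr=\frac12((1-\eta)c-\eta a+(1+2\eta)r)$, $cq=\frac12((1-\eta)c-\eta b+(1+2\eta)q)$; $as=\frac12((1-\eta)a-\eta q+(1+2\eta)s)$, $bt=\frac12((1-\eta)b-\eta r+(1+2\eta)t)$; $bs=\frac14(-\eta a+(1-2\eta^2)b+(\eta-2\eta^2)c+2\eta p+(4\eta^2-2\eta)q-r+2s+2t)$; $cs=\frac14(-3\eta a-(2\eta^2+2\eta-1)c+(2\eta+1)(p+2r-\eta b)+(4\eta^2+2)q-2t)$; $at=\frac14((1-2\eta^2)a-\eta b+(\eta-2\eta^2)c+2\eta p-q+(4\eta^2-2\eta)r+2s+2t)$; $ct=\frac14(-3\eta b-(2\eta^2+2\eta-1)c+(2\eta+1)(p+2q-\eta a)+(4\eta^2+2)r-2s)$; $p^2=\frac14((1-4\eta)(a+b)+(8\eta+2)p)$, $q^2=\frac14((1-4\eta)(b+c)+(8\eta+2)q)$, $r^2=\frac14((1-4\eta)(a+c)+(8\eta+2)r)$; $pq=\frac14(-3\eta(a+c)+(1-4\eta)b+(2\eta+1)(2p+2q+r)-2t)$;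 $pr=\frac14((1-4\eta)a-3\eta(b+c)+(2\eta+1)(2p+q+2r)-2s)$; $qr=\frac14(-\eta(a+b)+(1-2\eta)c-p+2\eta(q+r)+2s+2t)$; $ps=\frac18((2-8\eta)a-(2\eta^2+5\eta-1)b-(2\eta^2+\eta)c+(10\eta+2)p+(4\eta^2-2\eta+1)q+2\eta r+(4\eta+2)s)$; $qs=\frac18(-4\eta a-(4\eta^2+3\eta-1)(b+c)+(4\eta-1)(p+r)+(8\eta^2+2\eta+2)q+6s)$; $rs=\frac18((2-8\eta)a-(2\eta^2+\eta)b-(2\eta^2+5\eta-1)c+2\eta p+(4\eta^2-2\eta+1)q+(10\eta+2)r+(4\eta+2)s)$; $pt=\frac18((1-5\eta-2\eta^2)a+(2-8\eta)b-(2\eta^2+\eta)c+(10\eta+2)p+2\eta q+(4\eta^2-2\eta+1)r+(4\eta+2)t)$; $qt=\frac18(-(2\eta^2+\eta)a+(2-8\eta)b+(1-5\eta-2\eta^2)c+2\eta p+(10\eta+2)q+(4\eta^2-2\eta+1)r+(4\eta+2)t)$; $rt=\frac18((1-3\eta-4\eta^2)(a+c)-4\eta b+(4\eta-1)(p+q)+(8\eta^2+2\eta+2)r+6t)$; $s^2=\frac1{16}((4-16\eta)a+(1-2\eta-8\eta^2)(b+c)+(8\eta-2)(p+r+(2\eta-1)q)+(16\eta+12)s)$; $t^2=\frac1{16}((1-2\eta-8\eta^2)(a+c)+(4-16\eta)b+(8\eta-2)(p+q+(2\eta-1)r)+(16\eta+12)t)$; $st=\frac1{16}((2-8\eta-6\eta^2)(a+b)+(1-12\eta^2)c+(12\eta-3)p+(12\eta^2-2\eta-1)(q+r)+(4\eta+8)(s+t))$.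 *)

(* Defs.v *)
From mathcomp Require Import all_boot all_algebra.

Set Implicit Arguments.
Unset Strict Implicit.
Unset Printing Implicit Defensive.

Import GRing.Theory.
Local Open Scope ring_scope.

(* A (not necessarily associative or unital) F-algebra is an F-module A, of
   arbitrary dimension, with a product mul : {bilinear A -> A -> A}.  Subspaces
   are Prop-valued predicates on A. *)

Definition eigsp (F : fieldType) (A : lmodType F) (mul : A -> A -> A)
    (a : A) (lam : F) : A -> Prop :=
  fun u => mul a u = lam *: u.

Definition sumsp (F : fieldType) (A : lmodType F) (U V : A -> Prop) :
    A -> Prop :=
  fun x => exists u v : A, [/\ U u, V v & x = u + v].

Definition direct_sum3 (F : fieldType) (A : lmodType F)
    (U V W : A -> Prop) : Prop :=
  (forall x : A, exists u v w : A, [/\ U u, V v, W w & x = u + v + w]) /\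
  (forall u v w : A, U u -> V v -> W w -> u + v + w = 0 ->
     [/\ u = 0, v = 0 & w = 0]).

Definition prod_sub (F : fieldType) (A : lmodType F) (mul : A -> A -> A)
    (U V W : A -> Prop) : Prop :=
  forall u v : A, U u -> V v -> W (mul u v).

Record PC_axis (F : fieldType) (A : lmodType F) (mul : A -> A -> A)
    (eta : F) (a : A) : Prop := {
  PC_idem : mul a a = a;
  PC_decomp :
    direct_sum3 (eigsp mul a 1) (eigsp mul a eta) (eigsp mul a 2^-1);
  PC_11 : prod_sub mul (eigsp mul a 1) (eigsp mul a 1) (eigsp mul a 1);
  PC_1e : prod_sub mul (eigsp mul a 1) (eigsp mul a eta) (eigsp mul a eta);
  PC_1h : prod_sub mul (eigsp mul a 1) (eigsp mul a 2^-1) (eigsp mul a 2^-1);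
  PC_ee : prod_sub mul (eigsp mul a eta) (eigsp mul a eta) (eigsp mul a 1);
  PC_eh : prod_sub mul (eigsp mul a eta) (eigsp mul a 2^-1) (eigsp mul a 2^-1);
  PC_hh : prod_sub mul (eigsp mul a 2^-1) (eigsp mul a 2^-1)
            (sumsp (eigsp mul a 1) (eigsp mul a eta))
}.

Definition primitive_PC_axis (F : fieldType) (A : lmodType F)
    (mul : A -> A -> A) (eta : F) (a : A) : Prop :=
  [/\ PC_axis mul eta a,
      a != 0
    & forall u : A, eigsp mul a 1 u <-> exists k : F, u = k *: a].

Record subalgebra (F : fieldType) (A : lmodType F) (mul : A -> A -> A)
    (S : A -> Prop) : Prop := {
  subalg0 : S 0;
  subalgD : forall x y : A, S x -> S y -> S (x + y);
  subalgZ : forall (k : F) (x : A), S x -> S (k *: x);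
  subalgM : forall x y : A, S x -> S y -> S (mul x y)
}.

Definition generated_by (F : fieldType) (A : lmodType F) (mul : A -> A -> A)
    (X : A -> Prop) : Prop :=
  forall S : A -> Prop, subalgebra mul S -> (forall x, X x -> S x) ->
  forall x : A, S x.

Definition frobenius_form (F : fieldType) (A : lmodType F)
    (mul : A -> A -> A) (form : A -> A -> F) : Prop :=
  [/\ exists x y : A, form x y != 0,
      forall x y : A, form x y = form y x
    & forall x y z : A, form (mul x y) z = form x (mul y z)].

Definition in_span (F : fieldType) (A : lmodType F) (n : nat)
    (v : n.-tuple A) (x : A) : Prop :=
  exists k : 'I_n -> F, x = \sum_(i < n) k i *: tnth v i.

Definition gram_mx (F : fieldType) (A : lmodType F) (form : A -> A -> F)
    (n : nat) (v : n.-tuple A) : 'M[F]_n :=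
  \matrix_(i < n, j < n) form (tnth v i) (tnth v j).

(* Lm1 is the multiplication table for eta = -1, and Leta the one for all other
   values of eta.  mul is meant to be commutative: only one of the products
   mul x y, mul y x is listed.  The same holds for form_values. *)
Record Lm1 (F : fieldType) (A : lmodType F) (mul : A -> A -> A)
    (alpha beta gamma psi : F) (a b c p q r s t : A) : Prop := {
  Lm1_aa : mul a a = a;
  Lm1_bb : mul b b = b;
  Lm1_cc : mul c c = c;
  Lm1_ab : mul a b = p;
  Lm1_ac : mul a c = r;
  Lm1_bc : mul b c = q;
  Lm1_aq : mul a q = s;
  Lm1_br : mul b r = t;
  Lm1_cp : mul c p = beta *: a + gamma *: b + alpha *: c - s - t;
  Lm1_ap : mul a p = alpha *: a + 2^-1 *: b - 2^-1 *: p;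
  Lm1_ar : mul a r = gamma *: a + 2^-1 *: c - 2^-1 *: r;
  Lm1_bp : mul b p = alpha *: b + 2^-1 *: a - 2^-1 *: p;
  Lm1_bq : mul b q = beta *: b + 2^-1 *: c - 2^-1 *: q;
  Lm1_cr : mul c r = gamma *: c + 2^-1 *: a - 2^-1 *: r;
  Lm1_cq : mul c q = beta *: c + 2^-1 *: b - 2^-1 *: q;
  Lm1_as : mul a s = psi *: a + 2^-1 *: q - 2^-1 *: s;
  Lm1_bt : mul b t = psi *: b + 2^-1 *: r - 2^-1 *: t;
  Lm1_bs : mul b s = 4^-1 *:
    (beta *: a + (gamma - 2 * psi) *: b - (3 * alpha) *: c - (2 * beta) *: p
     + (6 * alpha) *: q - r + 2 *: s + 2 *: t);
  Lm1_cs : mul c s = 4^-1 *: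
    ((3 * beta) *: a - gamma *: b + (3 * alpha - 2 * psi) *: c - p
     + (6 * gamma) *: q - (2 * beta) *: r - 2 *: t);
  Lm1_at : mul a t = 4^-1 *:
    ((beta - 2 * psi) *: a + gamma *: b - (3 * alpha) *: c - (2 * gamma) *: p
     - q + (6 * alpha) *: r + 2 *: s + 2 *: t);
  Lm1_ct : mul c t = 4^-1 *:
    (- (beta *: a) + (3 * gamma) *: b + (3 * alpha - 2 * psi) *: c - p
     - (2 * gamma) *: q + (6 * beta) *: r - 2 *: s);
  Lm1_pp : mul p p = 4^-1 *:
    ((6 * alpha - 1) *: (a + b) - (4 * alpha + 2) *: p);
  Lm1_qq : mul q q = 4^-1 *:
    ((6 * beta - 1) *: (b + c) - (4 * beta + 2) *: q);
  Lm1_rr : mul r r = 4^-1 *: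
    ((6 * gamma - 1) *: (a + c) - (4 * gamma + 2) *: r);
  Lm1_pq : mul p q = 4^-1 *:
    ((3 * beta) *: a + (6 * psi - gamma) *: b + (3 * alpha) *: c
     - (2 * beta) *: p - (2 * alpha) *: q - r - 2 *: t);
  Lm1_qr : mul q r = 4^-1 *:
    (beta *: a + gamma *: b + (6 * psi - 3 * alpha) *: c - p
     - (2 * gamma) *: q - (2 * beta) *: r + 2 *: s + 2 *: t);
  Lm1_pr : mul p r = 4^-1 *:
    ((6 * psi - beta) *: a + (3 * gamma) *: b + (3 * alpha) *: c
     - (2 * gamma) *: p - q - (2 * alpha) *: r - 2 *: s);
  Lm1_ps : mul p s = 8^-1 *:
    ((12 * alpha * beta - 2 * beta + 6 * gamma - 6 * psi) *: a
     + (6 * psi - 2 * beta) *: b - c - (4 * (beta + psi)) *: p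
     + (6 * alpha + 1) *: q - 2 *: r + (2 - 4 * alpha) *: s);
  Lm1_pt : mul p t = 8^-1 *:
    ((6 * psi - 2 * gamma) *: a
     + (12 * alpha * gamma + 6 * beta - 2 * gamma - 6 * psi) *: b - c
     - (4 * (gamma + psi)) *: p - 2 *: q + (6 * alpha + 1) *: r
     + (2 - 4 * alpha) *: t);
  Lm1_qs : mul q s = 8^-1 *:
    ((4 * beta ^+ 2 - 2 * beta + 2) *: a + (1 - 6 * beta) *: p
     + (8 * psi) *: q + (1 - 6 * beta) *: r + (4 * beta + 2) *: s);
  Lm1_qt : mul q t = 8^-1 *:
    (- a + (12 * beta * gamma + 6 * alpha - 2 * gamma - 6 * psi) *: b
     + (6 * psi - 2 * gamma) *: c - 2 *: p - (4 * (gamma + psi)) *: q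
     + (6 * beta + 1) *: r + (2 - 4 * beta) *: t);
  Lm1_rs : mul r s = 8^-1 *:
    ((12 * beta * gamma + 6 * alpha - 2 * beta - 6 * psi) *: a - b
     + (6 * psi - 2 * beta) *: c - 2 *: p + (6 * gamma + 1) *: q
     - (4 * (beta + psi)) *: r + (2 - 4 * gamma) *: s);
  Lm1_rt : mul r t = 8^-1 *:
    ((4 * gamma ^+ 2 - 2 * gamma + 2) *: b + (1 - 6 * gamma) *: p
     + (1 - 6 * gamma) *: q + (8 * psi) *: r + (4 * gamma + 2) *: t);
  Lm1_ss : mul s s = 16^-1 *:
    ((36 * alpha * beta - 4 * beta ^+ 2 + 36 * beta * gamma - 24 * beta * psi
      - 6 * alpha + 2 * beta - 6 * gamma - 12 * psi - 2) *: a
     + (1 - 6 * beta) *: (b + c) + (2 * (1 - 6 * beta)) *: (p + r)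
     + (4 * beta + 24 * psi + 2) *: q + (8 * beta - 16 * psi + 4) *: s);
  Lm1_tt : mul t t = 16^-1 *:
    ((1 - 6 * gamma) *: (a + c)
     + (36 * alpha * gamma + 36 * beta * gamma - 4 * gamma ^+ 2
        - 24 * gamma * psi - 6 * alpha - 6 * beta + 2 * gamma - 12 * psi
        - 2) *: b
     + (2 - 12 * gamma) *: (p + q) + (4 * gamma + 24 * psi + 2) *: r
     + (8 * gamma - 16 * psi + 4) *: t);
  Lm1_st : mul s t = 16^-1 *:
    ((12 * beta * psi - 6 * alpha * beta - 2 * beta ^+ 2 - 14 * beta * gamma
      + beta + 6 * gamma + 6 * psi + 1) *: a
     + (12 * gamma * psi - 6 * alpha * gamma - 14 * beta * gamma
        - 2 * gamma ^+ 2 + 6 * beta + gamma + 6 * psi + 1) *: b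
     + (18 * alpha ^+ 2 + 6 * alpha * beta + 6 * alpha * gamma
        - 36 * alpha * psi + 3 * alpha - 6 * psi - 2) *: c
     + (6 * gamma - 6 * alpha + 6 * beta - 32 * beta * gamma + 12 * psi
        - 1) *: p
     + (24 * alpha * gamma - 6 * alpha + 2 * beta + 6 * gamma - 12 * psi
        - 1) *: q
     + (24 * alpha * beta - 6 * alpha + 6 * beta + 2 * gamma - 12 * psi
        - 1) *: r
     + (8 * gamma - 12 * alpha - 4 * beta + 16 * psi - 4) *: s
     + (8 * beta - 12 * alpha - 4 * gamma + 16 * psi - 4) *: t)
}.

Record Leta (F : fieldType) (A : lmodType F) (mul : A -> A -> A)
    (eta : F) (a b c p q r s t : A) : Prop := {
  Leta_aa : mul a a = a;
  Leta_bb : mul b b = b;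
  Leta_cc : mul c c = c;
  Leta_ab : mul a b = p;
  Leta_ac : mul a c = r;
  Leta_bc : mul b c = q;
  Leta_aq : mul a q = s;
  Leta_br : mul b r = t;
  Leta_cp : mul c p =
    (eta + 1) *: (p + q + r) - eta *: (a + b + c) - s - t;
  Leta_ap : mul a p = 2^-1 *:
    ((1 - eta) *: a - eta *: b + (1 + 2 * eta) *: p);
  Leta_ar : mul a r = 2^-1 *:
    ((1 - eta) *: a - eta *: c + (1 + 2 * eta) *: r);
  Leta_bp : mul b p = 2^-1 *:
    ((1 - eta) *: b - eta *: a + (1 + 2 * eta) *: p);
  Leta_bq : mul b q = 2^-1 *:
    ((1 - eta) *: b - eta *: c + (1 + 2 * eta) *: q);
  Leta_cr : mul c r = 2^-1 *:
    ((1 - eta) *: c - eta *: a + (1 + 2 * eta) *: r);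
  Leta_cq : mul c q = 2^-1 *:
    ((1 - eta) *: c - eta *: b + (1 + 2 * eta) *: q);
  Leta_as : mul a s = 2^-1 *:
    ((1 - eta) *: a - eta *: q + (1 + 2 * eta) *: s);
  Leta_bt : mul b t = 2^-1 *:
    ((1 - eta) *: b - eta *: r + (1 + 2 * eta) *: t);
  Leta_bs : mul b s = 4^-1 *:
    (- (eta *: a) + (1 - 2 * eta ^+ 2) *: b + (eta - 2 * eta ^+ 2) *: c
     + (2 * eta) *: p + (4 * eta ^+ 2 - 2 * eta) *: q - r + 2 *: s + 2 *: t);
  Leta_cs : mul c s = 4^-1 *:
    (- ((3 * eta) *: a) - (2 * eta ^+ 2 + 2 * eta - 1) *: c
     + (2 * eta + 1) *: (p + 2 *: r - eta *: b) + (4 * eta ^+ 2 + 2) *: q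
     - 2 *: t);
  Leta_at : mul a t = 4^-1 *:
    ((1 - 2 * eta ^+ 2) *: a - eta *: b + (eta - 2 * eta ^+ 2) *: c
     + (2 * eta) *: p - q + (4 * eta ^+ 2 - 2 * eta) *: r + 2 *: s + 2 *: t);
  Leta_ct : mul c t = 4^-1 *:
    (- ((3 * eta) *: b) - (2 * eta ^+ 2 + 2 * eta - 1) *: c
     + (2 * eta + 1) *: (p + 2 *: q - eta *: a) + (4 * eta ^+ 2 + 2) *: r
     - 2 *: s);
  Leta_pp : mul p p = 4^-1 *:
    ((1 - 4 * eta) *: (a + b) + (8 * eta + 2) *: p);
  Leta_qq : mul q q = 4^-1 *:
    ((1 - 4 * eta) *: (b + c) + (8 * eta + 2) *: q);
  Leta_rr : mul r r = 4^-1 *: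
    ((1 - 4 * eta) *: (a + c) + (8 * eta + 2) *: r);
  Leta_pq : mul p q = 4^-1 *:
    (- ((3 * eta) *: (a + c)) + (1 - 4 * eta) *: b
     + (2 * eta + 1) *: (2 *: p + 2 *: q + r) - 2 *: t);
  Leta_pr : mul p r = 4^-1 *:
    ((1 - 4 * eta) *: a - (3 * eta) *: (b + c)
     + (2 * eta + 1) *: (2 *: p + q + 2 *: r) - 2 *: s);
  Leta_qr : mul q r = 4^-1 *:
    (- (eta *: (a + b)) + (1 - 2 * eta) *: c - p + (2 * eta) *: (q + r)
     + 2 *: s + 2 *: t);
  Leta_ps : mul p s = 8^-1 *:
    ((2 - 8 * eta) *: a - (2 * eta ^+ 2 + 5 * eta - 1) *: b
     - (2 * eta ^+ 2 + eta) *: c + (10 * eta + 2) *: p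
     + (4 * eta ^+ 2 - 2 * eta + 1) *: q + (2 * eta) *: r
     + (4 * eta + 2) *: s);
  Leta_qs : mul q s = 8^-1 *:
    (- ((4 * eta) *: a) - (4 * eta ^+ 2 + 3 * eta - 1) *: (b + c)
     + (4 * eta - 1) *: (p + r) + (8 * eta ^+ 2 + 2 * eta + 2) *: q
     + 6 *: s);
  Leta_rs : mul r s = 8^-1 *:
    ((2 - 8 * eta) *: a - (2 * eta ^+ 2 + eta) *: b
     - (2 * eta ^+ 2 + 5 * eta - 1) *: c + (2 * eta) *: p
     + (4 * eta ^+ 2 - 2 * eta + 1) *: q + (10 * eta + 2) *: r
     + (4 * eta + 2) *: s);
  Leta_pt : mul p t = 8^-1 *:
    ((1 - 5 * eta - 2 * eta ^+ 2) *: a + (2 - 8 * eta) *: b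
     - (2 * eta ^+ 2 + eta) *: c + (10 * eta + 2) *: p + (2 * eta) *: q
     + (4 * eta ^+ 2 - 2 * eta + 1) *: r + (4 * eta + 2) *: t);
  Leta_qt : mul q t = 8^-1 *:
    (- ((2 * eta ^+ 2 + eta) *: a) + (2 - 8 * eta) *: b
     + (1 - 5 * eta - 2 * eta ^+ 2) *: c + (2 * eta) *: p
     + (10 * eta + 2) *: q + (4 * eta ^+ 2 - 2 * eta + 1) *: r
     + (4 * eta + 2) *: t);
  Leta_rt : mul r t = 8^-1 *:
    ((1 - 3 * eta - 4 * eta ^+ 2) *: (a + c) - (4 * eta) *: b
     + (4 * eta - 1) *: (p + q) + (8 * eta ^+ 2 + 2 * eta + 2) *: r
     + 6 *: t);
  Leta_ss : mul s s = 16^-1 *: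
    ((4 - 16 * eta) *: a + (1 - 2 * eta - 8 * eta ^+ 2) *: (b + c)
     + (8 * eta - 2) *: (p + r + (2 * eta - 1) *: q)
     + (16 * eta + 12) *: s);
  Leta_tt : mul t t = 16^-1 *:
    ((1 - 2 * eta - 8 * eta ^+ 2) *: (a + c) + (4 - 16 * eta) *: b
     + (8 * eta - 2) *: (p + q + (2 * eta - 1) *: r)
     + (16 * eta + 12) *: t);
  Leta_st : mul s t = 16^-1 *:
    ((2 - 8 * eta - 6 * eta ^+ 2) *: (a + b) + (1 - 12 * eta ^+ 2) *: c
     + (12 * eta - 3) *: p + (12 * eta ^+ 2 - 2 * eta - 1) *: (q + r)
     + (4 * eta + 8) *: (s + t))
}.

Record form_values (F : fieldType) (A : lmodType F) (form : A -> A -> F)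
    (alpha beta gamma psi : F) (a b c p q r s t : A) : Prop := {
  fv_aa : form a a = 1;
  fv_bb : form b b = 1;
  fv_cc : form c c = 1;
  fv_ab : form a b = alpha;
  fv_ac : form a c = gamma;
  fv_bc : form b c = beta;
  fv_ap : form a p = alpha;
  fv_aq : form a q = psi;
  fv_ar : form a r = gamma;
  fv_as : form a s = psi;
  fv_at : form a t = alpha * gamma + (beta - psi) / 2;
  fv_bp : form b p = alpha;
  fv_bq : form b q = beta;
  fv_br : form b r = psi;
  fv_bs : form b s = alpha * beta + (gamma - psi) / 2;
  fv_bt : form b t = psi;
  fv_cp : form c p = psi;
  fv_cq : form c q = beta;
  fv_cr : form c r = gamma;
  fv_cs : form c s = beta * gamma + (alpha - psi) / 2;
  fv_ct : form c t = beta * gamma + (alpha - psi) / 2;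
  fv_pp : form p p = (2 * alpha ^+ 2 - alpha + 1) / 2;
  fv_pq : form p q = (2 * alpha * beta + gamma - psi) / 2;
  fv_pr : form p r = (2 * alpha * gamma + beta - psi) / 2;
  fv_ps : form p s =
    (4 * alpha * psi + 2 * beta + psi - 2 * alpha * beta - gamma) / 4;
  fv_pt : form p t =
    (4 * alpha * psi + 2 * gamma + psi - 2 * alpha * gamma - beta) / 4;
  fv_qq : form q q = (2 * beta ^+ 2 - beta + 1) / 2;
  fv_qr : form q r = (2 * beta * gamma + alpha - psi) / 2;
  fv_qs : form q s =
    ((6 * beta - 1) * (alpha + gamma) - (4 * beta + 2) * psi) / 4;
  fv_qt : form q t =
    (4 * beta * psi + 2 * gamma + psi - 2 * beta * gamma - alpha) / 4;
  fv_rr : form r r = (2 * gamma ^+ 2 - gamma + 1) / 2;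
  fv_rs : form r s =
    (4 * gamma * psi + 2 * beta + psi - 2 * beta * gamma - alpha) / 4;
  fv_rt : form r t =
    ((6 * gamma - 1) * (alpha + beta) - (4 * gamma + 2) * psi) / 4;
  fv_ss : form s s =
    (4 * beta ^+ 2 - 6 * beta * gamma - 6 * alpha * beta + 4 * beta * psi
     + 8 * psi ^+ 2 + alpha - 2 * beta + gamma + 2 * psi + 2) / 8;
  fv_st : form s t =
    (8 * alpha * beta * gamma + 6 * alpha ^+ 2 - 6 * alpha * psi
     - 2 * beta ^+ 2 + 6 * beta * gamma + 2 * beta * psi - 2 * gamma ^+ 2
     + 2 * gamma * psi - 4 * psi ^+ 2 - 2 * alpha + beta + gamma - psi
     - 1) / 8;
  fv_tt : form t t =
    (4 * gamma ^+ 2 - 6 * alpha * gamma - 6 * beta * gamma + 4 * gamma * psi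
     + 8 * psi ^+ 2 + alpha + beta - 2 * gamma + 2 * psi + 2) / 8
}.

(* Main.v *)
(* For a primitive axis a and any u, the fusion law pins down the components
   of u: with lambda = (a, u), the vector y(u) = au - u/2 - (lambda/2)a lies in
   A_eta(a) and z(u) = au - eta u - (1 - eta)lambda a lies in A_{1/2}(a).
   Expanding y(u)y(v) in A_1(a), y(u)z(v) in A_{1/2}(a) and z(u)z(v) in
   A_1(a) + A_eta(a) expresses (au)(av) and a((au)v), and finally the cyclic sum
   (au)v + (av)u + a(uv), through products of lower degree.  Applied to a, b, c
   in turn these three identities give the whole multiplication table, once the
   form is known on the spanning set; the latter follows from associativity of
   the form.
   When eta <> -1, comparing the two expressions of (ab)(ab) given by a and b
   yields (alpha - 1)^3 = 0, and comparing the two expressions of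
   c(ab) + a(bc) + b(ac) given by a and b yields (psi - 1)(a - b) = 0, so that
   all values of the form on the spanning set are 1.
   For eta = -1 the Gram matrix splits, up to a triangular change of basis with
   constant diagonal, along the eigenspaces of a into two 4 x 4 blocks. *)
Require Import Defs.
From mathcomp Require Import all_boot all_algebra.
From mathcomp Require Import perm ring.

Set Implicit Arguments.
Unset Strict Implicit.
Unset Printing Implicit Defensive.

Import GRing.Theory.
Local Open Scope ring_scope.

(** * Linear identities in a module, checked coefficient by coefficient *)

Inductive lexp (F : Type) : Type :=
| LVar of nat
| LZero
| LAdd of lexp F & lexp F
| LOpp of lexp F
| LScale of F & lexp F.
Arguments LVar {F}.
Arguments LZero {F}.

Section LinearExpressions.
Variables (F : fieldType) (A : lmodType F).
Implicit Types (e : lexp F) (vs : seq A).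

Fixpoint lval vs e : A :=
  match e with
  | LVar i => vs`_i
  | LZero => 0
  | LAdd e1 e2 => lval vs e1 + lval vs e2
  | LOpp e1 => - lval vs e1
  | LScale k e1 => k *: lval vs e1
  end.

(* [None] stands for a zero coefficient, to keep the computed ones short. *)
Fixpoint lcoef e (i : nat) : option F :=
  match e with
  | LVar j => if eqn j i then Some 1 else None
  | LZero => None
  | LAdd e1 e2 =>
    match lcoef e1 i, lcoef e2 i with
    | Some k1, Some k2 => Some (k1 + k2)
    | Some k1, None => Some k1
    | None, k2 => k2
    end
  | LOpp e1 => if lcoef e1 i is Some k1 then Some (- k1) else None
  | LScale k e1 => if lcoef e1 i is Some k1 then Some (k * k1) else None
  end.

Definition oval (k : option F) : F := if k is Some k1 then k1 else 0.

Lemma lval_sum vs e :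
  lval vs e = \sum_(i < size vs) oval (lcoef e i) *: vs`_i.
Proof.
elim: e => [j||e1 IH1 e2 IH2|e IH|k e IH] /=.
- have [ltj|gej] := ltnP j (size vs); last first.
    (* An index past the end of [vs] reads the default [0], and no index of the sum equals it. *)
    rewrite nth_default // big1 // => i _.
    case: eqnP => [ji|_]; rewrite ?scale0r //.
    by have := ltn_ord i; rewrite -ji ltnNge gej.
  rewrite (bigD1 (Ordinal ltj)) //= eqnE eqxx scale1r big1 ?addr0 // => i ne_ij.
  case: eqP => [ji|_]; rewrite ?scale0r //.
  by case/eqP: ne_ij; apply: val_inj.
- by rewrite big1 // => i _; exact: scale0r.
- rewrite IH1 IH2 -big_split /=; apply: eq_bigr => i _; rewrite -scalerDl.
  by case: (lcoef e1 i) (lcoef e2 i) => [?|] [?|]; rewrite /= ?addr0 ?add0r.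
- rewrite IH -sumrN; apply: eq_bigr => i _; rewrite -scaleNr.
  by case: (lcoef e i) => [?|] //=; rewrite oppr0.
- rewrite IH scaler_sumr; apply: eq_bigr => i _; rewrite scalerA.
  by case: (lcoef e i) => [?|] //=; rewrite mulr0.
Qed.

(** The fold unfolds to one equation in the field per vector, so that no linear independence of the
    vectors is involved. *)
Lemma eq_lval vs e1 e2 :
  foldr (fun i P => oval (lcoef e1 i) = oval (lcoef e2 i) /\ P) True
    (iota 0 (size vs)) ->
  lval vs e1 = lval vs e2.
Proof.
move=> eq12; rewrite !lval_sum; apply: eq_bigr => i _; congr (_ *: _).
have : (i : nat) \in iota 0 (size vs) by rewrite mem_iota add0n ltn_ord.
elim: (iota _ _) eq12 => //= j l IH [eqj /IH{}IH].
by rewrite inE => /orP[/eqP->|/IH].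
Qed.

(** Turns the use of a known equation into a formal linear identity, which [module] can check. *)
Lemma lincomb (x y l r : A) (k : F) :
  l = r -> x - y = k *: (l - r) -> x = y.
Proof.
by move=> ->; rewrite subrr scaler0 => /eqP; rewrite subr_eq0 => /eqP.
Qed.

End LinearExpressions.

(** * Invertible powers of two and tactics for linear identities *)

Section Char2.
Variable F : fieldType.
Hypothesis charF : 2%N \notin [pchar F].

Lemma natr2_neq0 : 2 != 0 :> F.
Proof. by apply: contra charF => two0; rewrite inE /= two0. Qed.

(** The range 2 to 512 serves for the numeral denominators that [field] leaves as side
    conditions. *)
Lemma natr_pow2_neq0 n :
  n \in [seq 2 ^ k | k <- iota 1 9]%N -> n%:R != 0 :> F.
Proof. by case/mapP=> k _ ->; rewrite natrX expf_neq0 // natr2_neq0. Qed.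

End Char2.

(** Vectors are compared syntactically: a product and its mirror image count as different, so
    commutativity has to be normalised beforehand. *)
Ltac lexp_insert x l :=
  lazymatch l with
  | [::] => constr:([:: x])
  | x :: _ => l
  | ?y :: ?l' => let l'' := lexp_insert x l' in constr:(y :: l'')
  end.

Ltac lexp_vars l x :=
  lazymatch x with
  | ?y + ?z => let l' := lexp_vars l y in lexp_vars l' z
  | - ?y => lexp_vars l y
  | _ *: ?y => lexp_vars l y
  | 0 => l
  | _ => lexp_insert x l
  end.

Ltac lexp_index x l :=
  lazymatch l with
  | x :: _ => constr:(0%N)
  | _ :: ?l' => let n := lexp_index x l' in constr:(S n)
  end.

Ltac lexp_of l x :=
  lazymatch x with
  | ?y + ?z =>
    let e := lexp_of l y in let f := lexp_of l z in open_constr:(LAdd e f)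
  | - ?y => let e := lexp_of l y in open_constr:(LOpp e)
  | ?k *: ?y => let e := lexp_of l y in open_constr:(LScale k e)
  | 0 => open_constr:(LZero)
  | _ => let n := lexp_index x l in open_constr:(LVar n)
  end.

Ltac coefs :=
  lazymatch goal with
  | |- ?x = ?y :> ?A =>
    let l0 := lexp_vars (@nil A) x in
    let l := lexp_vars l0 y in
    let e := lexp_of l x in
    let f := lexp_of l y in
    apply: (@eq_lval _ _ l e f);
    cbn [oval lcoef foldr iota size eqn]; repeat split
  end.

Ltac charfield :=
  field; repeat (apply/andP; split);
  lazymatch goal with
  | |- is_true (_%:R != 0) => by apply: natr_pow2_neq0
  | |- _ => by []
  end.

Ltac module := coefs; charfield.

Ltac clear_context :=
  lazymatch goal with charF : is_true (2%N \notin _) |- _ => clear -charF end.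

Ltac cmodule := clear_context; module.

Ltac cfield := clear_context; charfield.

Section FrobeniusForm.
Variables (F : fieldType) (A : lmodType F) (mul : {bilinear A -> A -> A}).
Variable form : {biscalar A}.
Hypothesis form_frob : frobenius_form mul form.

Lemma frobC x y : form x y = form y x.
Proof. by case: form_frob. Qed.

Lemma frobA x y z : form (mul x y) z = form x (mul y z).
Proof. by case: form_frob. Qed.

Definition mulE :=
  (linearDl mul, linearDr mul, linearNl mul, linearNr mul,
   linearZl_LR mul, linearZr_LR mul).

Definition formE :=
  (linearDl form, linearDr form, linearNl form, linearNr form,
   linearZl_LR form, linearZr_LR form).

End FrobeniusForm.

(** * Eigenspaces and fusion law of one primitive axis *)

Section Axis.
Variables (F : fieldType) (charF : 2%N \notin [pchar F]) (eta : F).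
Hypotheses (eta_neq1 : eta != 1) (eta_neqh : eta != 2^-1).
Variables (A : lmodType F) (mul : {bilinear A -> A -> A}).
Hypothesis mulC : commutative mul.
Variable form : {biscalar A}.
Hypothesis form_frob : frobenius_form mul form.
Variable a : A.
Hypotheses (axis_a : primitive_PC_axis mul eta a) (form_aa : form a a = 1).

Let fC := frobC form_frob.
Let fA := frobA form_frob.

Lemma axis_idem : mul a a = a.
Proof. by case: axis_a => -[]. Qed.

Lemma eigsp1P x : eigsp mul a 1 x -> x = form a x *: a.
Proof.
case: axis_a => _ _ prim /prim[k ->].
by rewrite linearZr_LR /= form_aa mulr1.
Qed.

(** Associativity gives (a,x) = (aa,x) = (a,ax) = lam (a,x). *)
Lemma form_eigsp lam x : lam != 1 -> eigsp mul a lam x -> form a x = 0.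
Proof.
move=> lam1 ax; apply/eqP; have: (1 - lam) * form a x == 0.
  by rewrite mulrBl mul1r -{1}axis_idem fA ax linearZr_LR subrr.
by rewrite mulf_eq0 subr_eq0 eq_sym (negPf lam1).
Qed.

Lemma half_neq1 : 2^-1 != 1 :> F.
Proof.
rewrite invr_eq1 -subr_eq0 (_ : 2 - 1 = 1) ?oner_eq0 //; ring.
Qed.

(** With L the multiplication by [a], the operator (L - eta)(L - 1/2) kills A_eta and A_{1/2}, and
    acts on the A_1-component (a,u)a as the scalar (1 - eta)/2. *)
Lemma axis_mul2 u :
  mul a (mul a u) = (eta + 2^-1) *: mul a u - (eta / 2) *: u
    + ((1 - eta) / 2 * form a u) *: a.
Proof.
have [[_ [decomp _] _ _ _ _ _ _] _ _] := axis_a.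
have [x [y [z [x1 ye zh ->]]]] := decomp u.
rewrite !linearDr /= (form_eigsp eta_neq1 ye) (form_eigsp half_neq1 zh).
rewrite (eigsp1P x1) linearZr_LR /= axis_idem ye zh !linearZr_LR /= ye zh.
rewrite axis_idem form_aa.
module.
Qed.

(** These are the A_eta and A_{1/2} components of [u], scaled by eta - 1/2 and 1/2 - eta
    respectively to avoid division. *)
Definition eta_part u := mul a u - 2^-1 *: u - (form a u / 2) *: a.
Definition half_part u := mul a u - eta *: u - ((1 - eta) * form a u) *: a.

Lemma eigsp_eta_part u : eigsp mul a eta (eta_part u).
Proof.
rewrite /eigsp /eta_part !mulE axis_mul2 axis_idem; module.
Qed.

Lemma eigsp_half_part u : eigsp mul a 2^-1 (half_part u).
Proof.
rewrite /eigsp /half_part !mulE axis_mul2 axis_idem; module.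
Qed.

Lemma form_mul_mul u v :
  form (mul a u) (mul a v) =
    (eta + 2^-1) * form a (mul u v) - eta / 2 * form u v
    + (1 - eta) / 2 * (form a u * form a v).
Proof.
rewrite (mulC a u) fA axis_mul2 !formE /= (fC u a) -fA (mulC u a) fA.
ring.
Qed.

Lemma form_a_mul u : form a (mul a u) = form a u.
Proof. by rewrite -fA axis_idem. Qed.

(** The condition eta != 1/2 in the shape in which [field] asks for it. *)
Lemma eta_neqh_field : 1 + - eta * 2 != 0.
Proof.
have two0 := natr2_neq0 charF.
apply: contra eta_neqh => /eqP eta_h; rewrite -(inj_eq (mulIf two0)) mulVf //.
by rewrite eq_sym -subr_eq0 -mulNr eta_h.
Qed.

(* The fusion law only gives an undetermined multiple of [a]; pairing with [a]
   recovers the coefficient. *)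
Lemma axis_coef x y k l :
  x - y = k *: a -> form a x - form a y = l -> x = y + l *: a.
Proof.
move=> /(canRL (subrK y))-> <-; rewrite !formE /= form_aa; module.
Qed.

Lemma form_a_mulA u v : form a (mul (mul a u) v) = form (mul a u) (mul a v).
Proof. by rewrite fC fA (mulC v a). Qed.

Lemma axis_mul_mul u v :
  mul (mul a u) (mul a v) =
    2^-1 *: (mul (mul a u) v + mul (mul a v) u) - 4^-1 *: mul u v
    + (eta / 2) *: (form a v *: mul a u + form a u *: mul a v)
    - (eta / 4) *: (form a v *: u + form a u *: v)
    + ((eta - 2^-1) * (eta * form a (mul u v) - eta / 2 * form u v
        - (1 + eta) / 2 * (form a u * form a v))) *: a.
Proof.
have [[_ _ _ _ _ ee _ _] _ _] := axis_a.
have := eigsp1P (ee _ _ (eigsp_eta_part u) (eigsp_eta_part v)).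
set k := form a (mul _ _); rewrite /eta_part !mulE (mulC _ a) (mulC _ a).
rewrite (mulC u (mul a v)) !axis_mul2 axis_idem => Ek.
(* [k] is the coefficient of y(u)y(v) along [a]; the other summand collects the multiples of [a]
   that arise when this product is expanded with [axis_mul2]. *)
apply: (@axis_coef _ _ (k + (4^-1 - eta / 2) * (form a u * form a v))).
  apply: (lincomb (k := 1) Ek); module.
rewrite !formE /= (form_a_mulA u (mul a v)) !form_a_mulA axis_mul2.
rewrite !formE /= !form_a_mul !form_mul_mul (fC _ a) form_a_mul fA.
rewrite (mulC v u) (fC v u).
charfield.
Qed.

Lemma axis_mul_half u v :
  mul a (mul (mul a u) v) =
    2^-1 *: (mul a (mul u v) + mul (mul a u) v) - 4^-1 *: mul u v
    + (eta * (eta - 2^-1) * form a v) *: mul a u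
    + (eta / 2 * form a u) *: mul a v
    - (eta / 2 * (eta - 2^-1) * form a v) *: u
    - (eta / 4 * form a u) *: v
    + (2^-1 * (eta * form a (mul u v) - eta / 2 * form u v
        + (1 + eta) * (1 - 2 * eta) / 2 * (form a u * form a v))) *: a.
Proof.
have [[_ _ _ _ _ _ eh _] _ _] := axis_a.
have := eh _ _ (eigsp_eta_part u) (eigsp_half_part v).
rewrite /eigsp /eta_part /half_part !mulE axis_idem !(mulC _ a).
rewrite !(mulC u (mul a v)) !axis_mul_mul !mulE !axis_mul2 !mulE !axis_mul2.
rewrite axis_idem (mulC (mul a v) u).
move=> Ehalf.
have nz := eta_neqh_field.
(* Once [axis_mul_mul] is substituted, (av)u cancels from y(u)z(v), and (au)v is left with the
   coefficient 1/2 - eta. *)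
by apply: (lincomb (k := (2^-1 - eta)^-1) Ehalf); module.
Qed.

(** Write z(u)z(v) = x + y with x in A_1 and y in A_eta. Multiplying by [a] gives eta(x + y) + (1 -
    eta)x. Here x = (a,x)a, and (a,x) = (a z(u), z(v)) = (z(u),z(v))/2. *)
Lemma mul_half_part u v :
  mul a (mul (half_part u) (half_part v)) =
    eta *: mul (half_part u) (half_part v)
    + ((1 - eta) / 2 * form (half_part u) (half_part v)) *: a.
Proof.
have [[_ _ _ _ _ _ _ hh] _ _] := axis_a.
have [x [y [x1 ye Exy]]] := hh _ _ (eigsp_half_part u) (eigsp_half_part v).
have : form a (mul (half_part u) (half_part v)) = form a x.
  by rewrite Exy linearDr /= (form_eigsp eta_neq1 ye) addr0.
rewrite -fA eigsp_half_part linearZl_LR /= -mulrA => ->.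
rewrite Exy linearDr /= ye (eigsp1P x1) linearZr_LR /= axis_idem.
rewrite linearZr_LR /= form_aa; module.
Qed.

Lemma axis_cyclic u v :
  mul (mul a u) v + mul (mul a v) u + mul a (mul u v) =
    (eta + 1) *: (mul u v + form a v *: mul a u + form a u *: mul a v)
    - eta *: (form a v *: u + form a u *: v)
    + ((eta + 1) * (form a (mul u v) - form a u * form a v)
       - eta * form u v) *: a.
Proof.
have := mul_half_part u v.
rewrite /half_part !mulE axis_idem !(mulC _ a) !(mulC u (mul a v)).
rewrite !axis_mul_mul !mulE !axis_mul2 !axis_mul_half (mulC v u) (fC v u).
rewrite !formE /= !form_mul_mul (fC _ a) !form_a_mul form_aa fA.
rewrite -(fA u a) (mulC u a) fA (fC u a) !mulE !axis_mul2 axis_idem => Ehh.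
have nz := eta_neqh_field.
(* After the substitutions each of the three terms of the cyclic sum has the coefficient (1/2 -
   eta)^2. *)
apply: (lincomb (k := (2^-1 - eta) ^- 2) Ehh).
module.
Qed.

End Axis.

Lemma axis_identities (F : fieldType) (charF : 2%N \notin [pchar F]) (eta : F)
    (eta_neq1 : eta != 1) (eta_neqh : eta != 2^-1) (A : lmodType F)
    (mul : {bilinear A -> A -> A}) (mulC : commutative mul)
    (form : {biscalar A}) (form_frob : frobenius_form mul form)
    (form1 : forall x, primitive_PC_axis mul eta x -> form x x = 1)
    (a : A) (axis_a : primitive_PC_axis mul eta a) :
  [/\ mul a a = a /\ form a a = 1,
      forall u, mul a (mul a u) =
        (eta + 2^-1) *: mul a u - (eta / 2) *: u
          + ((1 - eta) / 2 * form a u) *: a,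
      forall u v, mul (mul a u) (mul a v) =
        2^-1 *: (mul (mul a u) v + mul (mul a v) u) - 4^-1 *: mul u v
        + (eta / 2) *: (form a v *: mul a u + form a u *: mul a v)
        - (eta / 4) *: (form a v *: u + form a u *: v)
        + ((eta - 2^-1) * (eta * form a (mul u v) - eta / 2 * form u v
            - (1 + eta) / 2 * (form a u * form a v))) *: a,
      forall u v, mul a (mul (mul a u) v) =
        2^-1 *: (mul a (mul u v) + mul (mul a u) v) - 4^-1 *: mul u v
        + (eta * (eta - 2^-1) * form a v) *: mul a u
        + (eta / 2 * form a u) *: mul a v
        - (eta / 2 * (eta - 2^-1) * form a v) *: u
        - (eta / 4 * form a u) *: v
        + (2^-1 * (eta * form a (mul u v) - eta / 2 * form u v
            + (1 + eta) * (1 - 2 * eta) / 2 * (form a u * form a v))) *: a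
    & forall u v, mul (mul a u) v + mul (mul a v) u + mul a (mul u v) =
        (eta + 1) *: (mul u v + form a v *: mul a u + form a u *: mul a v)
        - eta *: (form a v *: u + form a u *: v)
        + ((eta + 1) * (form a (mul u v) - form a u * form a v)
           - eta * form u v) *: a].
Proof.
split; first by split; [exact: axis_idem axis_a | exact: form1].
- exact: axis_mul2 (form1 _ axis_a).
- exact: axis_mul_mul (form1 _ axis_a).
- exact: axis_mul_half (form1 _ axis_a).
- exact: axis_cyclic (form1 _ axis_a).
Qed.

(** * The two multiplication tables *)

(** Rewrite rules that put each pair into basis order, used both with the product and with the form
    as [op]. *)
Definition sort8 T R (op : T -> T -> R) (opC : forall x y, op x y = op y x)
    (a b c p q r s t : T) :=
  (opC b a, opC c a, opC c b, opC p a, opC p b, opC p c, opC q a, opC q b,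
   opC q c, opC q p, opC r a, opC r b, opC r c, opC r p, opC r q, opC s a,
   opC s b, opC s c, opC s p, opC s q, opC s r, opC t a, opC t b, opC t c,
   opC t p, opC t q, opC t r, opC t s).

Ltac known sort :=
  rewrite ?sort; repeat match goal with H : _ = _ |- _ => rewrite !H end.

(** Inserting a known product creates sums inside other products and form values, hence the repeated
    alternation with bilinearity. *)
Ltac expand mul form sort :=
  known sort; rewrite ?(mulE mul) ?(formE form) /=;
  known sort; rewrite ?(mulE mul) ?(formE form) /=;
  known sort; rewrite ?(formE form) /=; known sort.

(* Establishes the next argument of the record constructor [build], keeping it
   as [h] for the following ones. *)
Ltac next_field build h :=
  lazymatch type of build with
  | ?P -> _ => have h : P; [ | move: (build h) => {}build ]
  end.

(** [E] is an instance of an axis identity in which the wanted product is the only unknown one; [k]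
    is the inverse of its coefficient. *)
Ltac entry build h k E mul form sort :=
  next_field build h;
  [ have := E; expand mul form sort; let e := fresh in move=> e;
    apply: (lincomb (k := k) e); cmodule | ].

(** Products are found by increasing degree in the axes. The form values come from moving one factor
    across the form onto a product found earlier. *)
Lemma products_m1 (F : fieldType) (charF : 2%N \notin [pchar F]) (eta : F)
    (eta_neq1 : eta != 1) (eta_neqh : eta != 2^-1) (A : lmodType F)
    (mul : {bilinear A -> A -> A}) (mulC : commutative mul)
    (form : {biscalar A}) (form_frob : frobenius_form mul form)
    (form1 : forall x, primitive_PC_axis mul eta x -> form x x = 1)
    (a b c p q r s t : A) (alpha beta gamma psi : F) :
    primitive_PC_axis mul eta a -> primitive_PC_axis mul eta b ->
    primitive_PC_axis mul eta c ->
    mul a b = p -> mul a c = r -> mul b c = q -> mul a q = s -> mul b r = t ->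
    form a b = alpha -> form b c = beta -> form a c = gamma ->
    form a q = psi -> eta = -1 ->
  Lm1 mul alpha beta gamma psi a b c p q r s t /\
  form_values form alpha beta gamma psi a b c p q r s t.
Proof.
move=> axis_a axis_b axis_c mul_ab mul_ac mul_bc mul_aq mul_br.
move=> form_ab form_bc form_ac form_aq eta_m1.
have fC := frobC form_frob; have fA := frobA form_frob.
have [[maa faa] sqa mma hfa cya] :=
  axis_identities charF eta_neq1 eta_neqh mulC form_frob form1 axis_a.
have [[mbb fbb] sqb mmb hfb cyb] :=
  axis_identities charF eta_neq1 eta_neqh mulC form_frob form1 axis_b.
have [[mcc fcc] sqc mmc hfc cyc] :=
  axis_identities charF eta_neq1 eta_neqh mulC form_frob form1 axis_c.
pose sort := (sort8 mulC a b c p q r s t, sort8 fC a b c p q r s t).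
have fap : form a p = alpha by rewrite -mul_ab -fA maa.
have far : form a r = gamma by rewrite -mul_ac -fA maa.
have fas : form a s = psi by rewrite -mul_aq -fA maa.
have fbr : form b r = psi.
  by rewrite -mul_ac -fA (mulC b) fA mul_bc.
have fbp : form b p = alpha by rewrite -mul_ab mulC -fA mbb fC.
have fbq : form b q = beta by rewrite -mul_bc -fA mbb.
have fbt : form b t = psi by rewrite -mul_br -fA mbb.
have fcp : form c p = psi by rewrite -mul_ab -fA (mulC c) mul_ac fC.
have fcq : form c q = beta by rewrite -mul_bc mulC -fA mcc fC.
have fcr : form c r = gamma by rewrite -mul_ac mulC -fA mcc fC.
have build := @Build_Lm1 F A mul alpha beta gamma psi a b c p q r s t
  maa mbb mcc mul_ab mul_ac mul_bc mul_aq mul_br.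
(* This cyclic sum is cp + s + t; for eta = -1 the terms with the factor eta + 1 vanish. *)
entry build cp (1 : F) (cya b c) mul form sort.
entry build ap (1 : F) (sqa b) mul form sort.
entry build ar (1 : F) (sqa c) mul form sort.
entry build bp (1 : F) (sqb a) mul form sort.
entry build bq (1 : F) (sqb c) mul form sort.
entry build cr (1 : F) (sqc a) mul form sort.
entry build cq (1 : F) (sqc b) mul form sort.
entry build mas (1 : F) (sqa q) mul form sort.
entry build bt (1 : F) (sqb r) mul form sort.
entry build bs (1 : F) (hfb c a) mul form sort.
entry build cs (1 : F) (hfc b a) mul form sort.
entry build mat (1 : F) (hfa c b) mul form sort.
entry build ct (1 : F) (hfc a b) mul form sort.
entry build pp (1 : F) (mma b b) mul form sort.
entry build qq (1 : F) (mmb c c) mul form sort.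
entry build rr (1 : F) (mma c c) mul form sort.
entry build pq (1 : F) (mmb a c) mul form sort.
entry build qr (1 : F) (mmc b a) mul form sort.
entry build pr (1 : F) (mma b c) mul form sort.
(* Products of degree four being known, the rest of the form follows; values such as (q,q) and (q,t)
   enter the products of degree five and six. *)
have fpr : form p r = (2 * alpha * gamma + beta - psi) / 2.
  by rewrite -mul_ab mulC fA ar; expand mul form sort; cfield.
have fat : form a t = alpha * gamma + (beta - psi) / 2.
  by rewrite -mul_br -fA mul_ab fpr; cfield.
have fpq : form p q = (2 * alpha * beta + gamma - psi) / 2.
  by rewrite -mul_ab fA bq; expand mul form sort; cfield.
have fbs : form b s = alpha * beta + (gamma - psi) / 2.
  by rewrite -mul_aq -fA (mulC b) mul_ab fpq; cfield.
have fqr : form q r = (2 * beta * gamma + alpha - psi) / 2.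
  by rewrite -mul_bc fA cr; expand mul form sort; cfield.
have fcs : form c s = beta * gamma + (alpha - psi) / 2.
  by rewrite -mul_aq -fA (mulC c) mul_ac fC fqr; cfield.
have fct : form c t = beta * gamma + (alpha - psi) / 2.
  by rewrite -mul_br -fA (mulC c) mul_bc fqr; cfield.
have fpp : form p p = (2 * alpha ^+ 2 - alpha + 1) / 2.
  by rewrite -{1}mul_ab fA bp; expand mul form sort; cfield.
have fqq : form q q = (2 * beta ^+ 2 - beta + 1) / 2.
  by rewrite -{1}mul_bc fA cq; expand mul form sort; cfield.
have frr : form r r = (2 * gamma ^+ 2 - gamma + 1) / 2.
  by rewrite -{1}mul_ac fA cr; expand mul form sort; cfield.
have fps : form p s =
    (4 * alpha * psi + 2 * beta + psi - 2 * alpha * beta - gamma) / 4.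
  by rewrite -mul_ab mulC fA mas; expand mul form sort; cfield.
have fpt : form p t =
    (4 * alpha * psi + 2 * gamma + psi - 2 * alpha * gamma - beta) / 4.
  by rewrite -mul_ab fA bt; expand mul form sort; cfield.
have fqs : form q s =
    ((6 * beta - 1) * (alpha + gamma) - (4 * beta + 2) * psi) / 4.
  by rewrite fC -mul_aq fA qq; expand mul form sort; cfield.
have fqt : form q t =
    (4 * beta * psi + 2 * gamma + psi - 2 * beta * gamma - alpha) / 4.
  by rewrite -mul_bc mulC fA bt; expand mul form sort; cfield.
have frs : form r s =
    (4 * gamma * psi + 2 * beta + psi - 2 * beta * gamma - alpha) / 4.
  by rewrite -mul_ac mulC fA mas; expand mul form sort; cfield.
have frt : form r t =
    ((6 * gamma - 1) * (alpha + beta) - (4 * gamma + 2) * psi) / 4.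
  by rewrite fC -mul_br fA rr; expand mul form sort; cfield.
have fss : form s s =
    (4 * beta ^+ 2 - 6 * beta * gamma - 6 * alpha * beta + 4 * beta * psi
     + 8 * psi ^+ 2 + alpha - 2 * beta + gamma + 2 * psi + 2) / 8.
  by rewrite -{1}mul_aq (mulC a) fA mas; expand mul form sort; cfield.
have fst : form s t =
    (8 * alpha * beta * gamma + 6 * alpha ^+ 2 - 6 * alpha * psi
     - 2 * beta ^+ 2 + 6 * beta * gamma + 2 * beta * psi - 2 * gamma ^+ 2
     + 2 * gamma * psi - 4 * psi ^+ 2 - 2 * alpha + beta + gamma - psi
     - 1) / 8.
  by rewrite -{1}mul_aq (mulC a) fA mat; expand mul form sort; cfield.
have ftt : form t t =
    (4 * gamma ^+ 2 - 6 * alpha * gamma - 6 * beta * gamma + 4 * gamma * psi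
     + 8 * psi ^+ 2 + alpha + beta - 2 * gamma + 2 * psi + 2) / 8.
  by rewrite -{1}mul_br (mulC b) fA bt; expand mul form sort; cfield.
entry build ps (1 : F) (mma b q) mul form sort.
entry build pt (1 : F) (mmb a r) mul form sort.
(* The first two terms of this cyclic sum are both qs, hence the factor 1/2. *)
entry build qs (2^-1 : F) (cya q q) mul form sort.
entry build qt (1 : F) (mmb c r) mul form sort.
entry build rs (1 : F) (mma c q) mul form sort.
entry build rt (2^-1 : F) (cyb r r) mul form sort.
entry build ss (1 : F) (mma q q) mul form sort.
entry build mtt (1 : F) (mmb r r) mul form sort.
(* In (aq)t + (at)q + a(qt) only the first term, st, is still unknown. *)
entry build mst (1 : F) (cya q t) mul form sort.
by split; first exact: build.
Qed.

(** Same scheme as [products_m1]; now all form values on the basis are 1, so the structure constants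
    depend on eta alone. *)
Lemma products_eta (F : fieldType) (charF : 2%N \notin [pchar F]) (eta : F)
    (eta_neq1 : eta != 1) (eta_neqh : eta != 2^-1) (A : lmodType F)
    (mul : {bilinear A -> A -> A}) (mulC : commutative mul)
    (form : {biscalar A}) (form_frob : frobenius_form mul form)
    (form1 : forall x, primitive_PC_axis mul eta x -> form x x = 1)
    (a b c p q r s t : A) :
    primitive_PC_axis mul eta a -> primitive_PC_axis mul eta b ->
    primitive_PC_axis mul eta c ->
    mul a b = p -> mul a c = r -> mul b c = q -> mul a q = s -> mul b r = t ->
    form a b = 1 -> form b c = 1 -> form a c = 1 -> form a q = 1 ->
  Leta mul eta a b c p q r s t.
Proof.
move=> axis_a axis_b axis_c mul_ab mul_ac mul_bc mul_aq mul_br.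
move=> form_ab form_bc form_ac form_aq.
have fC := frobC form_frob; have fA := frobA form_frob.
have [[maa faa] sqa mma hfa cya] :=
  axis_identities charF eta_neq1 eta_neqh mulC form_frob form1 axis_a.
have [[mbb fbb] sqb mmb hfb cyb] :=
  axis_identities charF eta_neq1 eta_neqh mulC form_frob form1 axis_b.
have [[mcc fcc] sqc mmc hfc cyc] :=
  axis_identities charF eta_neq1 eta_neqh mulC form_frob form1 axis_c.
pose sort := (sort8 mulC a b c p q r s t, sort8 fC a b c p q r s t).
have fap : form a p = 1 by rewrite -mul_ab -fA maa.
have far : form a r = 1 by rewrite -mul_ac -fA maa.
have fas : form a s = 1 by rewrite -mul_aq -fA maa.
have fbr : form b r = 1.
  by rewrite -mul_ac -fA (mulC b) fA mul_bc.
have fbp : form b p = 1 by rewrite -mul_ab mulC -fA mbb fC.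
have fbq : form b q = 1 by rewrite -mul_bc -fA mbb.
have fbt : form b t = 1 by rewrite -mul_br -fA mbb.
have fcp : form c p = 1 by rewrite -mul_ab -fA (mulC c) mul_ac fC.
have fcq : form c q = 1 by rewrite -mul_bc mulC -fA mcc fC.
have fcr : form c r = 1 by rewrite -mul_ac mulC -fA mcc fC.
have build := @Build_Leta F A mul eta a b c p q r s t
  maa mbb mcc mul_ab mul_ac mul_bc mul_aq mul_br.
entry build cp (1 : F) (cya b c) mul form sort.
entry build ap (1 : F) (sqa b) mul form sort.
entry build ar (1 : F) (sqa c) mul form sort.
entry build bp (1 : F) (sqb a) mul form sort.
entry build bq (1 : F) (sqb c) mul form sort.
entry build cr (1 : F) (sqc a) mul form sort.
entry build cq (1 : F) (sqc b) mul form sort.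
entry build mas (1 : F) (sqa q) mul form sort.
entry build bt (1 : F) (sqb r) mul form sort.
entry build bs (1 : F) (hfb c a) mul form sort.
entry build cs (1 : F) (hfc b a) mul form sort.
entry build mat (1 : F) (hfa c b) mul form sort.
entry build ct (1 : F) (hfc a b) mul form sort.
entry build pp (1 : F) (mma b b) mul form sort.
entry build qq (1 : F) (mmb c c) mul form sort.
entry build rr (1 : F) (mma c c) mul form sort.
entry build pq (1 : F) (mmb a c) mul form sort.
entry build pr (1 : F) (mma b c) mul form sort.
entry build qr (1 : F) (mmc b a) mul form sort.
have fpr : form p r = 1.
  by rewrite -mul_ab mulC fA ar; expand mul form sort; cfield.
have fat : form a t = 1.
  by rewrite -mul_br -fA mul_ab fpr; cfield.
have fpq : form p q = 1.
  by rewrite -mul_ab fA bq; expand mul form sort; cfield.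
have fbs : form b s = 1.
  by rewrite -mul_aq -fA (mulC b) mul_ab fpq; cfield.
have fqr : form q r = 1.
  by rewrite -mul_bc fA cr; expand mul form sort; cfield.
have fcs : form c s = 1.
  by rewrite -mul_aq -fA (mulC c) mul_ac fC fqr; cfield.
have fct : form c t = 1.
  by rewrite -mul_br -fA (mulC c) mul_bc fqr; cfield.
have fpp : form p p = 1.
  by rewrite -{1}mul_ab fA bp; expand mul form sort; cfield.
have fqq : form q q = 1.
  by rewrite -{1}mul_bc fA cq; expand mul form sort; cfield.
have frr : form r r = 1.
  by rewrite -{1}mul_ac fA cr; expand mul form sort; cfield.
have fps : form p s = 1.
  by rewrite -mul_ab mulC fA mas; expand mul form sort; cfield.
have fpt : form p t = 1.
  by rewrite -mul_ab fA bt; expand mul form sort; cfield.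
have fqs : form q s = 1.
  by rewrite fC -mul_aq fA qq; expand mul form sort; cfield.
have fqt : form q t = 1.
  by rewrite -mul_bc mulC fA bt; expand mul form sort; cfield.
have frs : form r s = 1.
  by rewrite -mul_ac mulC fA mas; expand mul form sort; cfield.
have frt : form r t = 1.
  by rewrite fC -mul_br fA rr; expand mul form sort; cfield.
have fss : form s s = 1.
  by rewrite -{1}mul_aq (mulC a) fA mas; expand mul form sort; cfield.
have fst : form s t = 1.
  by rewrite -{1}mul_aq (mulC a) fA mat; expand mul form sort; cfield.
have ftt : form t t = 1.
  by rewrite -{1}mul_br (mulC b) fA bt; expand mul form sort; cfield.
entry build ps (1 : F) (mma b q) mul form sort.
entry build qs (2^-1 : F) (cya q q) mul form sort.
entry build rs (1 : F) (mma c q) mul form sort.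
entry build pt (1 : F) (mmb a r) mul form sort.
entry build qt (1 : F) (mmb c r) mul form sort.
entry build rt (2^-1 : F) (cyb r r) mul form sort.
entry build ss (1 : F) (mma q q) mul form sort.
entry build mtt (1 : F) (mmb r r) mul form sort.
entry build mst (1 : F) (cya q t) mul form sort.
exact: build.
Qed.

(** * Form values of axes for eta != -1 *)

(** The formula for (ba)(ba) at the axis b is paired with a, and its left side (a(ab),ab) is
    evaluated by [axis_mul2] at a. The result is a cubic in (a,b) with triple root 1. *)
Lemma form_axes (F : fieldType) (charF : 2%N \notin [pchar F]) (eta : F)
    (eta_neq1 : eta != 1) (eta_neqh : eta != 2^-1) (A : lmodType F)
    (mul : {bilinear A -> A -> A}) (mulC : commutative mul)
    (form : {biscalar A}) (form_frob : frobenius_form mul form)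
    (form1 : forall x, primitive_PC_axis mul eta x -> form x x = 1) (a b : A) :
    primitive_PC_axis mul eta a -> primitive_PC_axis mul eta b ->
  eta != -1 -> form a b = 1.
Proof.
move=> axis_a axis_b eta_m1.
have fC := frobC form_frob; have fA := frobA form_frob.
have [[maa faa] sqa _ _ _] :=
  axis_identities charF eta_neq1 eta_neqh mulC form_frob form1 axis_a.
have [[mbb fbb] sqb mmb _ _] :=
  axis_identities charF eta_neq1 eta_neqh mulC form_frob form1 axis_b.
have faM x : form a (mul a x) = form a x by rewrite -fA maa.
have faab : form a (mul a b) = form a b by rewrite -fA maa.
have fbab : form b (mul a b) = form a b by rewrite mulC -fA mbb fC.
have fpp : form (mul a b) (mul a b) = (eta + 2^-1) * form a b - eta / 2
    + (1 - eta) / 2 * form a b ^+ 2.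
  rewrite {2}(mulC a) fA sqb !(formE form) /= (mulC b) faab faa (fC b a); ring.
have /(congr1 (form a)) := mmb a a.
rewrite maa !(mulC b a) -fA sqa !(formE form) /= (mulC _ a) faab fpp faa.
rewrite !faM (fC b a) fbab => e.
have : (form a b - 1) ^+ 3 * ((eta + 1) * (1 + - eta * 2)) = 0.
  move: e; set x := form a b; clearbody x; clear_context => e.
  (* The field is taken as a module over itself so that [lincomb] applies to scalars; -4 clears the
     denominators and adjusts the sign. *)
  apply: (@lincomb _ F^o _ _ _ _ (-4) e); rewrite /GRing.scale /=; charfield.
have nz : (eta + 1) * (1 + - eta * 2) != 0.
  by rewrite mulf_neq0 // ?(eta_neqh_field charF) // -[1]opprK subr_eq0.
by move/eqP; rewrite mulf_eq0 (negPf nz) orbF expf_eq0 subr_eq0 => /eqP.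
Qed.

(** * Closure of spans under products *)

Section Span.
Variables (F : fieldType) (A : lmodType F) (n : nat) (v : n.-tuple A).

Lemma in_span0 : in_span v 0.
Proof. by exists (fun=> 0); rewrite big1 // => i _; rewrite scale0r. Qed.

Lemma in_spanD x y : in_span v x -> in_span v y -> in_span v (x + y).
Proof.
move=> [k ->] [l ->]; exists (fun i => k i + l i).
by rewrite -big_split; apply: eq_bigr => i _; rewrite scalerDl.
Qed.

Lemma in_spanZ k x : in_span v x -> in_span v (k *: x).
Proof.
move=> [l ->]; exists (fun i => k * l i).
by rewrite scaler_sumr; apply: eq_bigr => i _; rewrite scalerA.
Qed.

Lemma in_spanN x : in_span v x -> in_span v (- x).
Proof. by rewrite -scaleN1r; exact: in_spanZ. Qed.

Lemma in_span_mem x : x \in v -> in_span v x.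
Proof.
case/tnthP=> i ->; exists (fun j => (j == i)%:R).
rewrite (bigD1 i) //= eqxx scale1r big1 ?addr0 // => j /negPf->.
by rewrite scale0r.
Qed.

Lemma in_span_sum (I : finType) (f : I -> A) :
  (forall i, in_span v (f i)) -> in_span v (\sum_i f i).
Proof.
by move=> vf; elim/big_rec: _ => [|i x _]; [exact: in_span0 | exact: in_spanD].
Qed.

Lemma in_span_subalgebra (mul : {bilinear A -> A -> A}) :
  (forall i j, in_span v (mul (tnth v i) (tnth v j))) ->
  subalgebra mul (in_span v).
Proof.
move=> vM; split; [exact: in_span0|exact: in_spanD|exact: in_spanZ|].
move=> x y [k ->] [l ->]; rewrite linear_sumlz; apply: in_span_sum => i.
rewrite linear_sumr; apply: in_span_sum => j.
by rewrite linearZl_LR linearZr_LR; do 2!apply: in_spanZ.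
Qed.

End Span.

Ltac rewrite_listed :=
  lazymatch goal with H : ?l = _ |- in_span _ ?l => rewrite H end.

(** The tables list each unordered pair once, so a product not found is looked up again with its
    factors exchanged. *)
Ltac in_span_products mulC :=
  case=> [[|[|[|[|[|[|[|[|]]]]]]]] ?] // [[|[|[|[|[|[|[|[|]]]]]]]] ?] //;
  rewrite !(tnth_nth 0) /=;
  first [rewrite_listed | rewrite mulC; rewrite_listed];
  repeat first [apply: in_spanD | apply: in_spanN | apply: in_spanZ];
  by apply: in_span_mem; rewrite !inE !eqxx ?orbT.

Lemma in_span_Lm1 (F : fieldType) (A : lmodType F)
    (mul : {bilinear A -> A -> A}) (mulC : commutative mul)
    (alpha beta gamma psi : F) (a b c p q r s t : A) :
  Lm1 mul alpha beta gamma psi a b c p q r s t ->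
  let B := [tuple a; b; c; p; q; r; s; t] in
  forall i j, in_span B (mul (tnth B i) (tnth B j)).
Proof.
case=> aa bb cc ab ac bc aq br cp ap ar bp bq cr cq as_ bt bs cs at_ ct pp qq rr
  pq qr pr ps pt qs qt rs rt ss tt st /=.
in_span_products mulC.
Qed.

Lemma in_span_Leta (F : fieldType) (A : lmodType F)
    (mul : {bilinear A -> A -> A}) (mulC : commutative mul) (eta : F)
    (a b c p q r s t : A) :
  Leta mul eta a b c p q r s t ->
  let B := [tuple a; b; c; p; q; r; s; t] in
  forall i j, in_span B (mul (tnth B i) (tnth B j)).
Proof.
case=> aa bb cc ab ac bc aq br cp ap ar bp bq cr cq as_ bt bs cs at_ ct pp qq rr
  pq pr qr ps qs rs pt qt rt ss tt st /=.
in_span_products mulC.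
Qed.

(** [axis_cyclic] at a and at b has the same left side; the right sides differ only in the term (eta
    + 1)(psi - 1) times the axis. *)
Lemma form_axes3 (F : fieldType) (charF : 2%N \notin [pchar F]) (eta : F)
    (eta_neq1 : eta != 1) (eta_neqh : eta != 2^-1) (A : lmodType F)
    (mul : {bilinear A -> A -> A}) (mulC : commutative mul)
    (form : {biscalar A}) (form_frob : frobenius_form mul form)
    (form1 : forall x, primitive_PC_axis mul eta x -> form x x = 1)
    (a b c : A) :
    primitive_PC_axis mul eta a -> primitive_PC_axis mul eta b ->
    primitive_PC_axis mul eta c ->
  eta != -1 -> form a (mul b c) = 1.
Proof.
move=> axis_a axis_b axis_c eta_m1.
have fC := frobC form_frob; have fA := frobA form_frob.
have form_axes x y :=
  @form_axes _ charF _ eta_neq1 eta_neqh _ _ mulC _ form_frob form1 x y.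
have [[maa faa] _ _ _ cya] :=
  axis_identities charF eta_neq1 eta_neqh mulC form_frob form1 axis_a.
have [_ _ _ _ cyb] :=
  axis_identities charF eta_neq1 eta_neqh mulC form_frob form1 axis_b.
have fab := form_axes _ _ axis_a axis_b eta_m1.
have fac := form_axes _ _ axis_a axis_c eta_m1.
have fbc := form_axes _ _ axis_b axis_c eta_m1.
have fbac : form b (mul a c) = form a (mul b c) by rewrite -!fA (mulC b).
set psi := form a (mul b c) in fbac *.
have : (psi - 1) * (eta + 1) *: (a - b) = 0.
  have := cya b c; have := cyb a c.
  rewrite (mulC b a) (mulC (mul b c) a) (mulC (mul a c) b) fbac (fC b a).
  rewrite fab fac fbc -/psi => e1 e2.
  apply: (lincomb (k := 1) e1); rewrite subr0; apply: (lincomb (k := -1) e2).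
  cmodule.
move/eqP; rewrite scaler_eq0 mulf_eq0 -[eta + 1]/(eta + 1) !subr_eq0.
rewrite addr_eq0 (negPf eta_m1) orbF => /orP[/eqP//|/eqP ab].
(* If a = b, then psi = (a,ac) = (a,c) = 1. *)
by rewrite /psi -ab -fA maa.
Qed.

(** * Gram determinants under a change of basis *)

Section Gram.
Variables (F : fieldType) (A : lmodType F) (form : {biscalar A}).

(** With G the Gram matrix of [v], that of [w] is T G T^t. *)
Lemma det_gram_change n (v w : 'I_n -> A) (T : 'M[F]_n) :
  (forall i, w i = \sum_j T i j *: v j) ->
  \det (\matrix_(i, j) form (w i) (w j)) =
    \det T ^+ 2 * \det (\matrix_(i, j) form (v i) (v j)).
Proof.
move=> wE; have -> : (\matrix_(i, j) form (w i) (w j)) =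
    T *m (\matrix_(i, j) form (v i) (v j)) *m T^T.
  apply/matrixP => i j; rewrite !mxE !wE linear_sumr; apply: eq_bigr => k _.
  rewrite linearZr_LR linear_sumlz mulrC !mxE; congr (_ * _).
  by apply: eq_bigr => l _; rewrite linearZl_LR !mxE.
by rewrite !det_mulmx det_tr mulrAC expr2.
Qed.

Lemma det_gram_perm n (v : 'I_n -> A) (s : 'S_n) :
  \det (\matrix_(i, j) form (v (s i)) (v (s j))) =
    \det (\matrix_(i, j) form (v i) (v j)).
Proof.
rewrite (@det_gram_change _ v (fun i => v (s i)) (perm_mx s)) => [|i].
  by rewrite det_perm sqrr_sign mul1r.
rewrite (bigD1 (s i)) //= !mxE eqxx scale1r big1 ?addr0 // => j ne_j.
by rewrite !mxE eq_sym (negPf ne_j) scale0r.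
Qed.

End Gram.

(** * Determinants by computation *)

Section LaplaceNat.
Variable F : comNzRingType.

(** [bump] by structural recursion, so that it reduces on numerals. *)
Fixpoint skip (j k : nat) : nat :=
  match j, k with
  | 0, _ => k.+1
  | j'.+1, 0 => 0
  | j'.+1, k'.+1 => (skip j' k').+1
  end%N.

Lemma skipE j k : skip j k = bump j k.
Proof. by elim: j k => [|j IH] [|k] //=; rewrite IH bumpS. Qed.

(* Laplace expansion along the first row, with indices that compute. *)
Fixpoint laplace n (f : nat -> nat -> F) : F :=
  if n is m.+1 then
    foldr (fun j x =>
        f 0 j * ((-1) ^+ j * laplace m (fun i k => f i.+1 (skip j k))) + x)
      0 (iota 0 n)
  else 1.

Lemma laplaceE n (f : nat -> nat -> F) :
  \det (\matrix_(i < n, j < n) f i j) = laplace n f.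
Proof.
elim: n f => [|n IH] f; first by rewrite det_mx00.
have -> : laplace n.+1 f = \sum_(0 <= j < n.+1)
    f 0%N j * ((-1) ^+ j * laplace n (fun i k => f i.+1 (skip j k))).
  by rewrite /index_iota subn0 unlock.
rewrite (expand_det_row _ ord0) big_mkord; apply: eq_bigr => j _.
rewrite mxE /cofactor add0n -IH; congr (_ * (_ * \det _)).
by apply/matrixP => i k; rewrite !mxE skipE /= /bump leq0n.
Qed.

End LaplaceNat.

Ltac value form sort :=
  rewrite ?(formE form) /=; known sort; cfield.

(** The change of basis multiplies the determinant by (3/2)^6, which is cancelled at the end because
    3 != 0. *)
Lemma det_gram_m1 (F : fieldType) (charF : 2%N \notin [pchar F])
    (A : lmodType F) (form : {biscalar A}) (a b c p q r s t : A)
    (alpha beta gamma psi : F) :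
  3 != 0 :> F -> (forall x y, form x y = form y x) ->
  form_values form alpha beta gamma psi a b c p q r s t ->
  \det (gram_mx form [tuple a; b; c; p; q; r; s; t]) =
    3 / 2 ^+ 9 * (alpha + beta + gamma - 2 * psi - 1) ^+ 4 *
    (12 * alpha * beta * gamma - 2 * alpha ^+ 2 - 2 * beta ^+ 2
     - 2 * gamma ^+ 2 - 2 * psi ^+ 2 + 2 * alpha * beta
     + 2 * beta * gamma + 2 * alpha * gamma - 4 * alpha * psi
     - 4 * beta * psi - 4 * gamma * psi + alpha + beta + gamma
     - 2 * psi + 1) ^+ 3.
Proof.
move=> char3 fC fv.
pose G (vs : seq A) := \det (\matrix_(i < 8, j < 8) form vs`_i vs`_j).
have -> : \det (gram_mx form [tuple a; b; c; p; q; r; s; t]) =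
    G [:: a; b; c; p; q; r; s; t].
  by congr (\det _); apply/matrixP => i j; rewrite !mxE !(tnth_nth 0).
(* The vectors y are in the eta-eigenspace of [a] and the vectors z in its
   1/2-eigenspace, so they are orthogonal to each other and to [a]; they
   replace the basis by two triangular changes of coordinates [T1], [T2]. *)
pose b1 := b - alpha *: a; pose c1 := c - gamma *: a; pose q1 := q - psi *: a.
pose zb := p + b - (2 * alpha) *: a; pose zc := r + c - (2 * gamma) *: a.
pose zq := s + q - (2 * psi) *: a.
(* In the algebra, 3/2 times [zt] is the [half_part] of [t] minus the combination of [zb], [zc],
   [zq] that removes [p], [r] and [s]. *)
pose zt := t - 2^-1 *: q - (3 / 2 * alpha) *: c + (gamma / 2) *: b
  + (psi - beta / 2) *: a.
pose yb := p - 2^-1 *: b - (alpha / 2) *: a.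
pose yc := r - 2^-1 *: c - (gamma / 2) *: a.
pose yq := s - 2^-1 *: q - (psi / 2) *: a.
(* This order matches b, c, q with their products p, r, s by [a], so that the y and z vectors end up
   in consecutive blocks. *)
have -> : G [:: a; b; c; p; q; r; s; t] = G [:: a; b; c; q; p; r; s; t].
  rewrite /G -(det_gram_perm form _ (tperm (inord 3) (inord 4))).
  congr (\det _); apply/matrixP => i j; rewrite !mxE.
  have E k : [:: a; b; c; p; q; r; s; t]`_(tperm (inord 3) (inord 4) k : 'I_8) =
       [:: a; b; c; q; p; r; s; t]`_k.
    rewrite permE /= -!val_eqE /= !inordK //.
    by case: k => [[|[|[|[|[|[|[|[|]]]]]]]] ?] //=; rewrite ?inordK.
  by rewrite !E.
(* Rows stop at their last non-zero entry; the default [0] fills the rest. *)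
pose M (rows : seq (seq F)) := \matrix_(i < 8, j < 8) (nth [::] rows i)`_j.
pose T1 : seq (seq F) := [:: [:: 1]; [:: - alpha; 1]; [:: - gamma; 0; 1];
  [:: - psi; 0; 0; 1];
  [:: - 2 * alpha; 1; 0; 0; 1]; [:: - 2 * gamma; 0; 1; 0; 0; 1];
  [:: - 2 * psi; 0; 0; 1; 0; 0; 1];
  [:: psi - beta / 2; gamma / 2; - (3 / 2 * alpha); - 2^-1; 0; 0; 0; 1]].
(* Encodes [yb = zb - 3/2 b1] and likewise for [yc], [yq], whence three diagonal entries -3/2. *)
pose T2 : seq (seq F) := [:: [:: 1];
  [:: 0; - (3 / 2); 0; 0; 1]; [:: 0; 0; - (3 / 2); 0; 0; 1];
  [:: 0; 0; 0; - (3 / 2); 0; 0; 1]; [:: 0; 0; 0; 0; 1]; [:: 0; 0; 0; 0; 0; 1];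
  [:: 0; 0; 0; 0; 0; 0; 1]; [:: 0; 0; 0; 0; 0; 0; 0; 1]].
have detT1 : \det (M T1) = 1.
  rewrite det_trig; last first.
    apply/is_trig_mxP => i j; rewrite !mxE.
    case: i => [[|[|[|[|[|[|[|[|]]]]]]]] ?] //; case: j =>
      [[|[|[|[|[|[|[|[|]]]]]]]] ?] //= _.
  by rewrite !big_ord_recr big_ord0 !mxE /= !mul1r.
have detT2 : \det (M T2) = (- (3 / 2)) ^+ 3.
  rewrite -det_tr det_trig; last first.
    apply/is_trig_mxP => i j; rewrite !mxE.
    case: i => [[|[|[|[|[|[|[|[|]]]]]]]] ?] //; case: j =>
      [[|[|[|[|[|[|[|[|]]]]]]]] ?] //= _.
  rewrite !big_ord_recr big_ord0 !mxE /= !mul1r !mulr1.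
  by rewrite !exprS expr0 mulr1 mulrA.
have E1 : G [:: a; b1; c1; q1; zb; zc; zq; zt] = G [:: a; b; c; q; p; r; s; t].
  rewrite /G (det_gram_change form (T := M T1)
    (v := fun i : 'I_8 => [:: a; b; c; q; p; r; s; t]`_i)).
    by rewrite detT1 expr1n mul1r.
  case=> [[|[|[|[|[|[|[|[|]]]]]]]] ?] //;
    rewrite !big_ord_recr big_ord0 !mxE /=;
    rewrite /b1 /c1 /q1 /zb /zc /zq /zt; module.
have E2 : G [:: a; yb; yc; yq; zb; zc; zq; zt] =
    (- (3 / 2)) ^+ 3 ^+ 2 * G [:: a; b1; c1; q1; zb; zc; zq; zt].
  rewrite /G (det_gram_change form (T := M T2)
    (v := fun i : 'I_8 => [:: a; b1; c1; q1; zb; zc; zq; zt]`_i)).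
    by rewrite detT2.
  case=> [[|[|[|[|[|[|[|[|]]]]]]]] ?] //;
    rewrite !big_ord_recr big_ord0 !mxE /=;
    rewrite /yb /yc /yq /zb /zc /zq /b1 /c1 /q1; module.
have [faa fbb fcc fab fac fbc fap faq far fas fat fbp fbq fbr fbs fbt fcp
  fcq fcr fcs fct fpp fpq fpr fps fpt fqq fqr fqs fqt frr frs frt fss fst
  ftt] := fv.
pose sort := sort8 fC a b c p q r s t.
have a_yb : form a yb = 0
  by rewrite /yb /yc /yq /zb /zc /zq /zt; value form sort.
have a_yc : form a yc = 0
  by rewrite /yb /yc /yq /zb /zc /zq /zt; value form sort.
have a_yq : form a yq = 0
  by rewrite /yb /yc /yq /zb /zc /zq /zt; value form sort.
have a_zb : form a zb = 0
  by rewrite /yb /yc /yq /zb /zc /zq /zt; value form sort.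
have a_zc : form a zc = 0
  by rewrite /yb /yc /yq /zb /zc /zq /zt; value form sort.
have a_zq : form a zq = 0
  by rewrite /yb /yc /yq /zb /zc /zq /zt; value form sort.
have a_zt : form a zt = 0
  by rewrite /yb /yc /yq /zb /zc /zq /zt; value form sort.
have yb_zb : form yb zb = 0
  by rewrite /yb /yc /yq /zb /zc /zq /zt; value form sort.
have yb_zc : form yb zc = 0
  by rewrite /yb /yc /yq /zb /zc /zq /zt; value form sort.
have yb_zq : form yb zq = 0
  by rewrite /yb /yc /yq /zb /zc /zq /zt; value form sort.
have yb_zt : form yb zt = 0
  by rewrite /yb /yc /yq /zb /zc /zq /zt; value form sort.
have yc_zb : form yc zb = 0
  by rewrite /yb /yc /yq /zb /zc /zq /zt; value form sort.
have yc_zc : form yc zc = 0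
  by rewrite /yb /yc /yq /zb /zc /zq /zt; value form sort.
have yc_zq : form yc zq = 0
  by rewrite /yb /yc /yq /zb /zc /zq /zt; value form sort.
have yc_zt : form yc zt = 0
  by rewrite /yb /yc /yq /zb /zc /zq /zt; value form sort.
have yq_zb : form yq zb = 0
  by rewrite /yb /yc /yq /zb /zc /zq /zt; value form sort.
have yq_zc : form yq zc = 0
  by rewrite /yb /yc /yq /zb /zc /zq /zt; value form sort.
have yq_zq : form yq zq = 0
  by rewrite /yb /yc /yq /zb /zc /zq /zt; value form sort.
have yq_zt : form yq zt = 0
  by rewrite /yb /yc /yq /zb /zc /zq /zt; value form sort.
have f_ybyb : form yb yb = (3 * alpha ^+ 2 - 6 * alpha + 3) / 4
  by rewrite /yb /yc /yq /zb /zc /zq /zt; value form sort.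
have f_ybyc : form yb yc =
    (3 * alpha * gamma + 3 * beta - 6 * psi) / 4
  by rewrite /yb /yc /yq /zb /zc /zq /zt; value form sort.
have f_ybyq : form yb yq =
    (-6 * alpha * beta + 3 * alpha * psi + 3 * beta - 3 * gamma + 3 * psi) / 4
  by rewrite /yb /yc /yq /zb /zc /zq /zt; value form sort.
have f_ycyc : form yc yc = (3 * gamma ^+ 2 - 6 * gamma + 3) / 4
  by rewrite /yb /yc /yq /zb /zc /zq /zt; value form sort.
have f_ycyq : form yc yq =
    (-6 * beta * gamma + 3 * gamma * psi - 3 * alpha + 3 * beta + 3 * psi) / 4
  by rewrite /yb /yc /yq /zb /zc /zq /zt; value form sort.
have f_yqyq : form yq yq =
    (-18 * alpha * beta + 6 * beta ^+ 2 - 18 * beta * gamma + 12 * beta * psi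
     + 6 * psi ^+ 2 + 3 * alpha - 3 * beta + 3 * gamma + 6 * psi + 3) / 8
  by rewrite /yb /yc /yq /zb /zc /zq /zt; value form sort.
have f_zbzb : form zb zb =
    (-6 * alpha ^+ 2 + 3 * alpha + 3) / 2
  by rewrite /yb /yc /yq /zb /zc /zq /zt; value form sort.
have f_zbzc : form zb zc =
    (-6 * alpha * gamma + 3 * beta + 3 * psi) / 2
  by rewrite /yb /yc /yq /zb /zc /zq /zt; value form sort.
have f_zbzq : form zb zq =
    (6 * alpha * beta - 12 * alpha * psi + 6 * beta + 3 * gamma - 3 * psi) / 4
  by rewrite /yb /yc /yq /zb /zc /zq /zt; value form sort.
have f_zbzt : form zb zt =
    (-12 * alpha * beta + 6 * alpha * psi - 3 * beta + 3 * gamma + 6 * psi) / 4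
  by rewrite /yb /yc /yq /zb /zc /zq /zt; value form sort.
have f_zczc : form zc zc =
    (-6 * gamma ^+ 2 + 3 * gamma + 3) / 2
  by rewrite /yb /yc /yq /zb /zc /zq /zt; value form sort.
have f_zczq : form zc zq =
    (6 * beta * gamma - 12 * gamma * psi + 3 * alpha + 6 * beta - 3 * psi) / 4
  by rewrite /yb /yc /yq /zb /zc /zq /zt; value form sort.
have f_zczt : form zc zt =
    (6 * beta * gamma + 6 * gamma * psi - 6 * alpha - 3 * beta - 3 * psi) / 4
  by rewrite /yb /yc /yq /zb /zc /zq /zt; value form sort.
have f_zqzq : form zq zq =
    (18 * alpha * beta + 12 * beta ^+ 2 + 18 * beta * gamma - 12 * beta * psi
     - 24 * psi ^+ 2 - 3 * alpha - 6 * beta - 3 * gamma - 6 * psi + 6) / 8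
  by rewrite /yb /yc /yq /zb /zc /zq /zt; value form sort.
have f_zqzt : form zq zt =
    (-18 * alpha * beta - 6 * beta ^+ 2 + 6 * beta * psi + 12 * psi ^+ 2
     - 3 * alpha + 3 * beta + 6 * gamma + 3 * psi - 3) / 8
  by rewrite /yb /yc /yq /zb /zc /zq /zt; value form sort.
have f_ztzt : form zt zt =
    (-36 * alpha * beta * gamma + 6 * alpha ^+ 2 + 12 * alpha * beta
     - 6 * alpha * gamma + 12 * alpha * psi - 6 * beta * gamma
     + 6 * gamma ^+ 2 + 12 * gamma * psi + 3 * alpha - 6 * gamma + 3) / 8
  by rewrite /yb /yc /yq /zb /zc /zq /zt; value form sort.
pose W := [:: a; yb; yc; yq; zb; zc; zq; zt].
(* The first block belongs to A_1 + A_eta, the second to A_{1/2}; the zero values above make the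
   matrix block diagonal. *)
have EW : G W = \det (\matrix_(i < 4, j < 4) form W`_i W`_j) *
    \det (\matrix_(i < 4, j < 4) form W`_(4 + i) W`_(4 + j)).
  rewrite -(det_ublock _ 0) /G; congr (\det _).
  apply/matrixP => i j; rewrite !mxE.
  case: (@splitP 4 4 i) => i1 ->; rewrite !mxE; case: (@splitP 4 4 j) => j1 ->;
    rewrite !mxE //.
  - by case: i1 => [[|[|[|[|]]]] ?] //; case: j1 => [[|[|[|[|]]]] ?].
  - by rewrite fC; case: i1 => [[|[|[|[|]]]] ?] //;
      case: j1 => [[|[|[|[|]]]] ?].
have E3 : (3 / 2) ^+ 6 * G [:: a; b; c; q; p; r; s; t] = G W.
  by rewrite /W E2 E1; ring.
pose sortW := (fC yb a, fC yc a, fC yq a, fC yc yb, fC yq yb, fC yq yc,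
  fC zc zb, fC zq zb, fC zq zc, fC zt zb, fC zt zc, fC zt zq).
pose L := alpha + beta + gamma - 2 * psi - 1.
pose Q := 12 * alpha * beta * gamma - 2 * alpha ^+ 2 - 2 * beta ^+ 2
  - 2 * gamma ^+ 2 - 2 * psi ^+ 2 + 2 * alpha * beta + 2 * beta * gamma
  + 2 * alpha * gamma - 4 * alpha * psi - 4 * beta * psi - 4 * gamma * psi
  + alpha + beta + gamma - 2 * psi + 1.
have D1 : \det (\matrix_(i < 4, j < 4) form W`_i W`_j) =
    27 / 128 * L ^+ 2 * Q.
  rewrite (laplaceE 4 (fun i j => form W`_i W`_j)) /= /L /Q.
  known sortW; cfield.
have D2 : \det (\matrix_(i < 4, j < 4) form W`_(4 + i) W`_(4 + j)) =
    81 / 256 * L ^+ 2 * Q ^+ 2.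
  rewrite (laplaceE 4 (fun i j => form W`_(4 + i) W`_(4 + j))) /= /L /Q.
  known sortW; cfield.
have two3 : (3 / 2) ^+ 6 != 0 :> F.
  by rewrite expf_neq0 // mulf_neq0 ?invr_eq0 // natr2_neq0.
(* The constants agree since 27/128 times 81/256 equals (3/2)^6 times 3/2^9. *)
apply: (mulfI two3); rewrite E3 EW D1 D2 /L /Q; cfield.
Qed.

(** * Generation by the axes and the two cases of eta *)

Theorem proposition6 (F : fieldType) (charF : 2%N \notin [pchar F])
  (eta : F) (eta_neq1 : eta != 1) (eta_neqh : eta != 2^-1)
  (A : lmodType F) (mul : {bilinear A -> A -> A}) (mulC : commutative mul)
  (a b c : A)
  (axis_a : primitive_PC_axis mul eta a)
  (axis_b : primitive_PC_axis mul eta b)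
  (axis_c : primitive_PC_axis mul eta c)
  (genA : generated_by mul (fun x => [\/ x = a, x = b | x = c]))
  (form : {biscalar A}) (form_frob : frobenius_form mul form)
  (form1 : forall x : A, primitive_PC_axis mul eta x -> form x x = 1) :
  let alpha := form a b in
  let beta := form b c in
  let gamma := form a c in
  let psi := form a (mul b c) in
  let p := mul a b in
  let q := mul b c in
  let r := mul a c in
  let s := mul a (mul b c) in
  let t := mul b (mul a c) in
  let B := [tuple a; b; c; p; q; r; s; t] in
  [/\ (forall x : A, in_span B x),
      (eta = -1 -> Lm1 mul alpha beta gamma psi a b c p q r s t) /\
      (eta <> -1 -> Leta mul eta a b c p q r s t)
    & eta = -1 ->
      form_values form alpha beta gamma psi a b c p q r s t /\
      \det (gram_mx form B) =
        3 / 2 ^+ 9 * (alpha + beta + gamma - 2 * psi - 1) ^+ 4 *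
        (12 * alpha * beta * gamma - 2 * alpha ^+ 2 - 2 * beta ^+ 2
         - 2 * gamma ^+ 2 - 2 * psi ^+ 2 + 2 * alpha * beta
         + 2 * beta * gamma + 2 * alpha * gamma - 4 * alpha * psi
         - 4 * beta * psi - 4 * gamma * psi + alpha + beta + gamma
         - 2 * psi + 1) ^+ 3].
Proof.
move=> alpha beta gamma psi p q r s t B.
have [eta_m1|eta_m1] := eqVneq eta (-1).
  have [tab fv] := products_m1 charF eta_neq1 eta_neqh mulC form_frob form1
    axis_a axis_b axis_c (erefl p) (erefl r) (erefl q) (erefl s) (erefl t)
    (erefl alpha) (erefl beta) (erefl gamma) (erefl psi) eta_m1.
  have spanB x : in_span B x.
    apply: genA => [|y]; first exact/in_span_subalgebra/(in_span_Lm1 mulC tab).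
    by case=> ->; apply: in_span_mem; rewrite !inE eqxx ?orbT.
  split=> // _; split=> //.
  apply: det_gram_m1 => //; last exact: frobC form_frob.
  (* In characteristic three -1 equals 1/2, an excluded value of eta. *)
  apply: contra eta_neqh => /eqP three0; rewrite eta_m1.
  have two0 := natr2_neq0 charF.
  rewrite -(inj_eq (mulfI two0)) (mulfV two0) -subr_eq0.
  have -> : 2 * -1 - 1 = - 3 :> F by ring.
  by rewrite three0 oppr0.
have tab : Leta mul eta a b c p q r s t.
  apply: (products_eta charF eta_neq1 eta_neqh mulC form_frob form1) => //.
  - exact: form_axes form1 _ _ axis_a axis_b eta_m1.
  - exact: form_axes form1 _ _ axis_b axis_c eta_m1.
  - exact: form_axes form1 _ _ axis_a axis_c eta_m1.
  - exact: form_axes3 form1 _ _ _ axis_a axis_b axis_c eta_m1.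
have spanB x : in_span B x.
  apply: genA => [|y]; first exact/in_span_subalgebra/(in_span_Leta mulC tab).
  by case=> ->; apply: in_span_mem; rewrite !inE eqxx ?orbT.
split=> // [|eta_eq]; last by rewrite eta_eq eqxx in eta_m1.
by split=> // eta_eq; rewrite eta_eq eqxx in eta_m1.
Qed.
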